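(* Let $\mathcal{C}$ be a fiat $2$-category and let $A$ and $B$ be two algebra $1$-morphisms in $\overline{\mathcal{C}}$. Then $\mathrm{mod}_{\overline{\mathcal{C}}}(A)$ and $\mathrm{mod}_{\overline{\mathcal{C}}}(B)$ are equivalent as $2$-representations of $\overline{\mathcal{C}}$ if and only if there exist biprojective bimodule $1$-morphisms $M={}_AM_B$ and $N={}_BN_A$ in $\overline{\mathcal{C}}$ and bimodule $2$-isomorphisms $$f\colon M\circ_BN\overset{\cong}{\longrightarrow}A\quad\text{and}\quad g\colon N\circ_AM\overset{\cong}{\longrightarrow}B$$ such that the following two diagrams commute: $$\lambda_M\circ_1(f\circ\mathrm{id}_M)=\rho_M\circ_1(\mathrm{id}_M\circ g)\colon M\circ_BN\circ_AM\to M,$$ $$\lambda_N\circ_1(g\circ\mathrm{id}_N)=\rho_N\circ_1(\mathrm{id}_N\circ f)\colon N\circ_AM\circ_BN\to N,$$ where $\lambda_M\colon A\circ_AM\to M$, $\rho_M\colon M\circ_BB\to M$, $\lambda_N\colon B\circ_BN\to N$, $\rho_N\colon N\circ_AA\to N$ are the isomorphisms induced by the actions.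
   Context: Fix an algebraically closed field $\mathbb{k}$; all ($2$-)categories and ($2$-)functors are $\mathbb{k}$-linear. Composition of $1$-morphisms is $\circ$ (or juxtaposition), horizontal and vertical compositions of $2$-morphisms are $\circ_0$ and $\circ_1$. A category is finitary if it is additive, $\mathbb{k}$-linear, has split idempotents, finitely many isomorphism classes of indecomposable objects and finite dimensional morphism spaces. A $2$-category $\mathcal{C}$ is finitary if it has finitely many objects, every $\mathcal{C}(\mathtt{i},\mathtt{j})$ is finitary, horizontal composition is additive and $\mathbb{k}$-linear, and every identity $1$-morphism $\mathbb{1}_{\mathtt{i}}$ is indecomposable. It is fiat if moreover it has a weak involution ${}^*\colon\mathcal{C}\to\mathcal{C}^{\mathrm{co,op}}$ (reversing both $1$- and $2$-morphisms) such that for all $\mathrm{F}\in\mathcal{C}(\mathtt{i},\mathtt{j})$ there are $2$-morphisms $\alpha\colon\mathrm{F}\mathrm{F}^*\to\mathbb{1}_{\mathtt{j}}$, $\beta\colon\mathbb{1}_{\mathtt{i}}\to\mathrm{F}^*\mathrm{F}$ satisfying the triangle (zig-zag) identities of an adjunction. Projective abelianization. For a finitary category $\mathcal{A}$, objects of $\overline{\mathcal{A}}$ are tuples $(X,k,Y_i,f_i)_{i\ge1}$ with $k\in\mathbb{Z}_{\ge0}$, $X,Y_i\in\mathcal{A}$, $f_i\colon Y_i\to X$ and $Y_i=0$ for $i>k$. Morphisms to $(X',k',Y'_i,f'_i)$ are tuples $(g\colon X\to X',\,h_{i,j}\colon Y_i\to Y'_j)$ with $gf_i=\sum_jf'_jh_{i,j}$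 for all $i$, modulo those tuples for which there are $q_i\colon X\to Y'_i$ with $\sum_if'_iq_i=g$; composition is $(g'g,\sum_kh'_{k,j}h_{i,k})$. This category is abelian and $X\mapsto(X,0,0,0)$ identifies $\mathcal{A}$ with its projective objects. The $2$-category $\overline{\mathcal{C}}$ has the objects of $\mathcal{C}$, $\overline{\mathcal{C}}(\mathtt{i},\mathtt{j})=\overline{\mathcal{C}(\mathtt{i},\mathtt{j})}$, and composition $(\mathrm{F},k,\mathrm{G}_i,\alpha_i)\circ(\mathrm{F}',k',\mathrm{G}'_i,\alpha'_i)=(\mathrm{F}\mathrm{F}',k+k',\mathrm{H}_i,\beta_i)$ with $\mathrm{H}_i=\mathrm{F}\mathrm{G}'_i$, $\beta_i=\mathrm{id}_{\mathrm{F}}\circ_0\alpha'_i$ for $1\le i\le k'$, and $\mathrm{H}_i=\mathrm{G}_{i-k'}\mathrm{F}'$, $\beta_i=\alpha_{i-k'}\circ_0\mathrm{id}_{\mathrm{F}'}$ for $k'<i\le k'+k$, zero otherwise; horizontal composition of $2$-morphisms is component-wise. Algebras, modules, bimodules. An algebra $1$-morphism in $\overline{\mathcal{C}}$ is $A\in\overline{\mathcal{C}}(\mathtt{i},\mathtt{i})$ (for some object $\mathtt{i}$) with associative, unital multiplication $A\circ A\to A$ and unit $\mathbb{1}_{\mathtt{i}}\to A$. $\mathrm{mod}_{\overline{\mathcal{C}}}(A)$ is the category of right $A$-module $1$-morphisms, i.e. $X\in\coprod_{\mathtt{j}}\overline{\mathcal{C}}(\mathtt{i},\mathtt{j})$ with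 an associative, unital action $X\circ A\to X$; it is a $2$-representation of $\overline{\mathcal{C}}$ (a $2$-functor to categories) via left composition, with value at $\mathtt{j}$ the modules in $\overline{\mathcal{C}}(\mathtt{i},\mathtt{j})$. Morphisms of $2$-representations are $2$-natural transformations (commuting with the action up to coherent natural isomorphism); $2$-representations are equivalent if there is such a morphism all of whose components are equivalences of categories. An $A$-$B$ bimodule $1$-morphism $M={}_AM_B$ has commuting left action $\lambda_M\colon A\circ M\to M$ and right action $\rho_M\colon M\circ B\to M$. For ${}_AM_B$ and ${}_BN_A$, $M\circ_BN$ is the cokernel of $\rho_M\circ_0\mathrm{id}_N-\mathrm{id}_M\circ_0\lambda_N\colon M\circ B\circ N\to M\circ N$, and $N\circ_AM$ etc. are defined similarly; associativity isomorphisms are suppressed. The actions descend to isomorphisms $A\circ_AM\cong M$ and $M\circ_BB\cong M$, denoted by the same symbols (similarly for $N$). A bimodule $1$-morphism is biprojective if it is projective as a left module $1$-morphism and as a right module $1$-morphism (not necessarily as a bimodule $1$-morphism). *)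

(* Defs.v *)
From HB Require Import structures.
From mathcomp Require Import all_boot all_order all_algebra.
From mathcomp Require Import boolp.

Set Implicit Arguments.
Unset Strict Implicit.
Unset Printing Implicit Defensive.

Import GRing.Theory.
Local Open Scope ring_scope.

Declare Scope cat_scope.
Delimit Scope cat_scope with C.
Local Open Scope cat_scope.

Reserved Notation "g \v f" (at level 40, left associativity).
Reserved Notation "b \h a" (at level 39, left associativity).
Reserved Notation "G \c F" (at level 38, left associativity).

Record lincat (K : fieldType) := LinCat {
  ob :> Type;
  hom : ob -> ob -> lmodType K;
  idm : forall X : ob, hom X X;
  comp : forall X Y Z : ob, hom Y Z -> hom X Y -> hom X Z;
  comp_linl : forall (X Y Z : ob) (f : hom X Y),
    linear (fun g : hom Y Z => comp g f);
  comp_linr : forall (X Y Z : ob) (g : hom Y Z),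
    linear (fun f : hom X Y => comp g f);
  compA : forall (W X Y Z : ob) (h : hom Y Z) (g : hom X Y) (f : hom W X),
    comp h (comp g f) = comp (comp h g) f;
  comp1m : forall (X Y : ob) (f : hom X Y), comp (idm Y) f = f;
  compm1 : forall (X Y : ob) (f : hom X Y), comp f (idm X) = f
}.
Arguments hom {K l} X Y.
Arguments idm {K l} X.
Arguments comp {K l X Y Z} g f.

Notation "g \v f" := (comp g f) : cat_scope.

Section LinCat.
Variables (K : fieldType) (A : lincat K).
Implicit Types X Y Z : A.

Definition eqm X Y (e : X = Y) : hom X Y :=
  match e in _ = Z return hom X Z with erefl => idm X end.

Definition is_iso X Y (f : hom X Y) : Prop :=
  exists g : hom Y X, g \v f = idm X /\ f \v g = idm Y.

Definition isomorphic X Y : Prop := exists f : hom X Y, is_iso f.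

Definition epi X Y (f : hom X Y) : Prop :=
  forall Z (g h : hom Y Z), g \v f = h \v f -> g = h.

Definition projective (P : A) : Prop :=
  forall X Y (e : hom X Y) (f : hom P Y), epi e -> exists g, e \v g = f.

Definition is_zero X : Prop := idm X = 0.

Definition is_biproduct X Y Z : Prop :=
  exists (i1 : hom X Z) (i2 : hom Y Z) (p1 : hom Z X) (p2 : hom Z Y),
  [/\ p1 \v i1 = idm X, p2 \v i2 = idm Y, p1 \v i2 = 0, p2 \v i1 = 0
    & i1 \v p1 + i2 \v p2 = idm Z].

Definition additive_cat : Prop :=
  (exists Z, is_zero Z) /\ (forall X Y, exists Z, is_biproduct X Y Z).

Definition idempotents_split : Prop :=
  forall X (e : hom X X), e \v e = e ->
  exists Y (r : hom X Y) (s : hom Y X), s \v r = e /\ r \v s = idm Y.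

Definition indecomposable X : Prop :=
  ~ is_zero X /\
  forall Y Z, is_biproduct Y Z X -> is_zero Y \/ is_zero Z.

Definition finitary_cat : Prop :=
  [/\ additive_cat, idempotents_split,
      (exists n (s : 'I_n -> A), forall X, indecomposable X ->
         exists x, isomorphic X (s x))
    & forall X Y, exists n, inhabited (Vector.axiom n (hom X Y))].

Definition is_coker X Y (f : hom X Y) (Q : A) (p : hom Y Q) : Prop :=
  p \v f = 0 /\
  forall R (u : hom Y R), u \v f = 0 ->
    exists v : hom Q R, v \v p = u /\ forall v', v' \v p = u -> v' = v.

Lemma comp0m X Y Z (f : hom X Y) : (0 : hom Y Z) \v f = 0.
Proof.
have := comp_linl f (-1) (0 : hom Y Z) 0.
by rewrite !scaleN1r !addNr.
Qed.

Lemma compm0 X Y Z (g : hom Y Z) : g \v (0 : hom X Y) = 0.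
Proof.
have := comp_linr g (-1) (0 : hom X Y) 0.
by rewrite !scaleN1r !addNr.
Qed.

Lemma compDl X Y Z (g g' : hom Y Z) (f : hom X Y) :
  (g + g') \v f = g \v f + g' \v f.
Proof. by have := comp_linl f 1 g g'; rewrite !scale1r. Qed.

Lemma compDr X Y Z (g : hom Y Z) (f f' : hom X Y) :
  g \v (f + f') = g \v f + g \v f'.
Proof. by have := comp_linr g 1 f f'; rewrite !scale1r. Qed.

Lemma compZl X Y Z a (g : hom Y Z) (f : hom X Y) :
  (a *: g) \v f = a *: (g \v f).
Proof. by have := comp_linl f a g 0; rewrite comp0m !addr0. Qed.

Lemma compZr X Y Z a (g : hom Y Z) (f : hom X Y) :
  g \v (a *: f) = a *: (g \v f).
Proof. by have := comp_linr g a f 0; rewrite compm0 !addr0. Qed.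

Lemma compNl X Y Z (g : hom Y Z) (f : hom X Y) : (- g) \v f = - (g \v f).
Proof. by rewrite -scaleN1r compZl scaleN1r. Qed.

Lemma compNr X Y Z (g : hom Y Z) (f : hom X Y) : g \v (- f) = - (g \v f).
Proof. by rewrite -scaleN1r compZr scaleN1r. Qed.

Lemma compBl X Y Z (g g' : hom Y Z) (f : hom X Y) :
  (g - g') \v f = g \v f - g' \v f.
Proof. by rewrite compDl compNl. Qed.

Lemma compBr X Y Z (g : hom Y Z) (f f' : hom X Y) :
  g \v (f - f') = g \v f - g \v f'.
Proof. by rewrite compDr compNr. Qed.

Lemma comp_suml X Y Z (I : finType) (G : I -> hom Y Z) (f : hom X Y) :
  (\sum_i G i) \v f = \sum_i G i \v f.
Proof.
by apply: (big_morph (fun g => g \v f)) => [g g'|]; rewrite ?comp0m ?compDl.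
Qed.

Lemma comp_sumr X Y Z (I : finType) (g : hom Y Z) (F : I -> hom X Y) :
  g \v (\sum_i F i) = \sum_i g \v F i.
Proof.
by apply: (big_morph (fun f => g \v f)) => [f f'|]; rewrite ?compm0 ?compDr.
Qed.

Lemma eqm_id X (e : X = X) : eqm e = idm X.
Proof. by rewrite (Prop_irrelevance e erefl). Qed.

Lemma eqm_trans X Y Z (e : X = Y) (e' : Y = Z) :
  eqm e' \v eqm e = eqm (etrans e e').
Proof. by case: Z / e'; rewrite /= comp1m. Qed.

Lemma eqmVm X Y (e : X = Y) : eqm (esym e) \v eqm e = idm X.
Proof. by rewrite eqm_trans eqm_id. Qed.

Lemma eqmmV X Y (e : X = Y) : eqm e \v eqm (esym e) = idm Y.
Proof. by rewrite eqm_trans eqm_id. Qed.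

Lemma coker_epi X Y (f : hom X Y) (Q : A) (p : hom Y Q) :
  is_coker f p -> epi p.
Proof.
move=> [pf0 univ] Z g h e.
have gpf : (g \v p) \v f = 0 by rewrite -compA pf0 compm0.
have [v [_ uniq_v]] := univ _ _ gpf.
by rewrite (uniq_v g) // (uniq_v h).
Qed.

Definition desc X Y (f : hom X Y) (Q : A) (p : hom Y Q) (cok : is_coker f p)
    R (u : hom Y R) (uf0 : u \v f = 0) : hom Q R :=
  sval (cid (cok.2 R u uf0)).

Lemma descE X Y (f : hom X Y) (Q : A) (p : hom Y Q) (cok : is_coker f p)
    R (u : hom Y R) (uf0 : u \v f = 0) : desc cok uf0 \v p = u.
Proof. by rewrite /desc; case: cid => v []. Qed.

End LinCat.

(* 1-morphisms compose strictly associatively and unitally; the corresponding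
   equations between 2-morphisms compare them through the identity 2-morphisms
   [eqm] of the equal 1-morphisms.                                          *)
Record twocat (K : fieldType) := TwoCat {
  obj :> Type;
  mor1 :> obj -> obj -> lincat K;
  one : forall i, mor1 i i;
  comp1 : forall i j l, mor1 j l -> mor1 i j -> mor1 i l;
  hcomp : forall i j l (G G' : mor1 j l) (F F' : mor1 i j),
    hom G G' -> hom F F' -> hom (comp1 G F) (comp1 G' F');
  hcomp_linl : forall i j l (G G' : mor1 j l) (F F' : mor1 i j)
    (a : hom F F'), linear (fun b : hom G G' => hcomp b a);
  hcomp_linr : forall i j l (G G' : mor1 j l) (F F' : mor1 i j)
    (b : hom G G'), linear (fun a : hom F F' => hcomp b a);
  hcomp_id : forall i j l (G : mor1 j l) (F : mor1 i j),
    hcomp (idm G) (idm F) = idm (comp1 G F);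
  interchange : forall i j l (G G' G'' : mor1 j l) (F F' F'' : mor1 i j)
    (b' : hom G' G'') (b : hom G G') (a' : hom F' F'') (a : hom F F'),
    hcomp (b' \v b) (a' \v a) = hcomp b' a' \v hcomp b a;
  comp1A : forall i j l m (H : mor1 l m) (G : mor1 j l) (F : mor1 i j),
    comp1 (comp1 H G) F = comp1 H (comp1 G F);
  comp1f : forall i j (F : mor1 i j), comp1 (one j) F = F;
  compf1 : forall i j (F : mor1 i j), comp1 F (one i) = F;
  hcompA : forall i j l m (H H' : mor1 l m) (G G' : mor1 j l)
    (F F' : mor1 i j) (c : hom H H') (b : hom G G') (a : hom F F'),
    eqm (comp1A H' G' F') \v hcomp (hcomp c b) a
      = hcomp c (hcomp b a) \v eqm (comp1A H G F);
  hcomp1m : forall i j (F F' : mor1 i j) (a : hom F F'),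
    eqm (comp1f F') \v hcomp (idm (one j)) a = a \v eqm (comp1f F);
  hcompm1 : forall i j (F F' : mor1 i j) (a : hom F F'),
    eqm (compf1 F') \v hcomp a (idm (one i)) = a \v eqm (compf1 F)
}.
Arguments one {K t} i.
Arguments comp1 {K t i j l} G F.
Arguments hcomp {K t i j l G G' F F'} b a.

Notation "G \c F" := (comp1 G F) : cat_scope.
Notation "b \h a" := (hcomp b a) : cat_scope.

Section TwoCat.
Variables (K : fieldType) (D : twocat K).

Definition asc i j l m (H : D l m) (G : D j l) (F : D i j) :
  hom ((H \c G) \c F) (H \c (G \c F)) := eqm (comp1A H G F).
Definition ascV i j l m (H : D l m) (G : D j l) (F : D i j) :
  hom (H \c (G \c F)) ((H \c G) \c F) := eqm (esym (comp1A H G F)).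
Definition lunit i j (F : D i j) : hom (one j \c F) F := eqm (comp1f F).
Definition lunitV i j (F : D i j) : hom F (one j \c F) :=
  eqm (esym (comp1f F)).
Definition runit i j (F : D i j) : hom (F \c one i) F := eqm (compf1 F).
Definition runitV i j (F : D i j) : hom F (F \c one i) :=
  eqm (esym (compf1 F)).

Definition finitary : Prop :=
  [/\ exists n (s : 'I_n -> D), forall i : D, exists x, s x = i,
      forall i j : D, finitary_cat (D i j)
    & forall i : D, indecomposable (one i : D i i)].

(* A weak involution: a k-linear pseudofunctor D -> D^{co,op} which is the
   identity on objects, together with a pseudonatural isomorphism from the
   identity to its square.                                                  *)
Record weak_involution := WeakInvolution {
  star : forall i j, D i j -> D j i;
  star2 : forall i j (F G : D i j), hom F G -> hom (star G) (star F);
  star2_lin : forall i j (F G : D i j), linear (@star2 i j F G);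
  star2_id : forall i j (F : D i j), star2 (idm F) = idm (star F);
  star2_comp : forall i j (F G H : D i j) (b : hom G H) (a : hom F G),
    star2 (b \v a) = star2 a \v star2 b;
  star_mul : forall i j l (G : D j l) (F : D i j),
    hom (star F \c star G) (star (G \c F));
  star_mul_iso : forall i j l (G : D j l) (F : D i j), is_iso (star_mul G F);
  star_mul_nat : forall i j l (G G' : D j l) (F F' : D i j)
    (b : hom G G') (a : hom F F'),
    star2 (b \h a) \v star_mul G' F' = star_mul G F \v (star2 a \h star2 b);
  star_one : forall i, hom (one i) (star (one i));
  star_one_iso : forall i, is_iso (star_one i);
  star_mulA : forall i j l m (H : D l m) (G : D j l) (F : D i j),
    star2 (ascV H G F) \v star_mul (H \c G) F
        \v (idm (star F) \h star_mul H G) \v asc (star F) (star G) (star H)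
      = star_mul H (G \c F) \v (star_mul G F \h idm (star H));
  star_mul1f : forall i j (F : D i j),
    star2 (lunitV F) \v star_mul (one j) F \v (idm (star F) \h star_one j)
      = runit (star F);
  star_mulf1 : forall i j (F : D i j),
    star2 (runitV F) \v star_mul F (one i) \v (star_one i \h idm (star F))
      = lunit (star F);
  starK : forall i j (F : D i j), hom F (star (star F));
  starK_iso : forall i j (F : D i j), is_iso (starK F);
  starK_nat : forall i j (F G : D i j) (a : hom F G),
    starK G \v a = star2 (star2 a) \v starK F;
  starK_mul : forall i j l (G : D j l) (F : D i j),
    star2 (star_mul G F) \v starK (G \c F)
      = star_mul (star F) (star G) \v (starK G \h starK F);
  starK_one : forall i, star2 (star_one i) \v starK (one i) = star_one i
}.

Definition adjunction_zigzag i j (F : D i j) (Fs : D j i)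
    (alpha : hom (F \c Fs) (one j)) (beta : hom (one i) (Fs \c F)) : Prop :=
  lunit F \v (alpha \h idm F) \v ascV F Fs F \v (idm F \h beta) \v runitV F
    = idm F /\
  runit Fs \v (idm Fs \h alpha) \v asc Fs F Fs \v (beta \h idm Fs)
    \v lunitV Fs = idm Fs.

Definition fiat : Prop :=
  finitary /\
  exists S : weak_involution, forall i j (F : D i j),
    exists (alpha : hom (F \c star S F) (one j))
           (beta : hom (one i) (star S F \c F)), adjunction_zigzag alpha beta.

Lemma hcomp0m i j l (G G' : D j l) (F F' : D i j) (a : hom F F') :
  (0 : hom G G') \h a = 0.
Proof.
have := hcomp_linl a (-1) (0 : hom G G') 0.
by rewrite !scaleN1r !addNr.
Qed.

Lemma hcompm0 i j l (G G' : D j l) (F F' : D i j) (b : hom G G') :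
  b \h (0 : hom F F') = 0.
Proof.
have := hcomp_linr b (-1) (0 : hom F F') 0.
by rewrite !scaleN1r !addNr.
Qed.

Lemma hcompDl i j l (G G' : D j l) (F F' : D i j) (b b' : hom G G')
  (a : hom F F') : (b + b') \h a = b \h a + b' \h a.
Proof. by have := hcomp_linl a 1 b b'; rewrite !scale1r. Qed.

Lemma hcompDr i j l (G G' : D j l) (F F' : D i j) (b : hom G G')
  (a a' : hom F F') : b \h (a + a') = b \h a + b \h a'.
Proof. by have := hcomp_linr b 1 a a'; rewrite !scale1r. Qed.

Lemma hcompZl i j l (G G' : D j l) (F F' : D i j) k (b : hom G G')
  (a : hom F F') : (k *: b) \h a = k *: (b \h a).
Proof. by have := hcomp_linl a k b 0; rewrite hcomp0m !addr0. Qed.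

Lemma hcompZr i j l (G G' : D j l) (F F' : D i j) k (b : hom G G')
  (a : hom F F') : b \h (k *: a) = k *: (b \h a).
Proof. by have := hcomp_linr b k a 0; rewrite hcompm0 !addr0. Qed.

Lemma hcompNl i j l (G G' : D j l) (F F' : D i j) (b : hom G G')
  (a : hom F F') : (- b) \h a = - (b \h a).
Proof. by rewrite -scaleN1r hcompZl scaleN1r. Qed.

Lemma hcompNr i j l (G G' : D j l) (F F' : D i j) (b : hom G G')
  (a : hom F F') : b \h (- a) = - (b \h a).
Proof. by rewrite -scaleN1r hcompZr scaleN1r. Qed.

Lemma hcompBl i j l (G G' : D j l) (F F' : D i j) (b b' : hom G G')
  (a : hom F F') : (b - b') \h a = b \h a - b' \h a.
Proof. by rewrite hcompDl hcompNl. Qed.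

Lemma hcompBr i j l (G G' : D j l) (F F' : D i j) (b : hom G G')
  (a a' : hom F F') : b \h (a - a') = b \h a - b \h a'.
Proof. by rewrite hcompDr hcompNr. Qed.

Lemma hcomp_suml i j l (G G' : D j l) (F F' : D i j) (I : finType)
  (b : I -> hom G G') (a : hom F F') : (\sum_x b x) \h a = \sum_x b x \h a.
Proof.
by apply: (big_morph (fun b => b \h a)) => [? ?|]; rewrite ?hcomp0m ?hcompDl.
Qed.

Lemma hcomp_sumr i j l (G G' : D j l) (F F' : D i j) (I : finType)
  (b : hom G G') (a : I -> hom F F') : b \h (\sum_x a x) = \sum_x b \h a x.
Proof.
by apply: (big_morph (fun a => b \h a)) => [? ?|]; rewrite ?hcompm0 ?hcompDr.
Qed.

End TwoCat.

Section Coherence.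
Variables (K : fieldType) (D : twocat K).

Lemma ascK i j l m (H : D l m) (G : D j l) (F : D i j) :
  ascV H G F \v asc H G F = idm _.
Proof. exact: eqmVm. Qed.

Lemma ascVK i j l m (H : D l m) (G : D j l) (F : D i j) :
  asc H G F \v ascV H G F = idm _.
Proof. exact: eqmmV. Qed.

Lemma asc_nat i j l m (H H' : D l m) (G G' : D j l) (F F' : D i j)
    (c : hom H H') (b : hom G G') (a : hom F F') :
  asc H' G' F' \v ((c \h b) \h a) = (c \h (b \h a)) \v asc H G F.
Proof. exact: hcompA. Qed.

Lemma ascV_nat i j l m (H H' : D l m) (G G' : D j l) (F F' : D i j)
    (c : hom H H') (b : hom G G') (a : hom F F') :
  ascV H' G' F' \v (c \h (b \h a)) = ((c \h b) \h a) \v ascV H G F.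
Proof.
rewrite -[LHS]compm1 -(ascVK H G F) compA -[_ \v _ \v asc _ _ _]compA.
by rewrite -asc_nat compA ascK comp1m.
Qed.

Lemma whiskl_comp i j l (G : D j l) (F F' F'' : D i j)
    (b : hom F' F'') (a : hom F F') :
  (idm G \h b) \v (idm G \h a) = idm G \h (b \v a).
Proof. by rewrite -interchange comp1m. Qed.

Lemma whiskr_comp i j l (G G' G'' : D j l) (F : D i j)
    (b : hom G' G'') (a : hom G G') :
  (b \h idm F) \v (a \h idm F) = (b \v a) \h idm F.
Proof. by rewrite -interchange comp1m. Qed.

Lemma whisk_lr i j l (G G' : D j l) (F F' : D i j) (b : hom G G')
    (a : hom F F') : (idm G' \h a) \v (b \h idm F) = b \h a.
Proof. by rewrite -interchange comp1m compm1. Qed.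

Lemma whisk_rl i j l (G G' : D j l) (F F' : D i j) (b : hom G G')
    (a : hom F F') : (b \h idm F') \v (idm G \h a) = b \h a.
Proof. by rewrite -interchange comp1m compm1. Qed.

Lemma eqm_irr (A : lincat K) (X Y : A) (e e' : X = Y) : eqm e = eqm e'.
Proof. by rewrite (Prop_irrelevance e e'). Qed.

Lemma whiskl_eqm i j l (G : D j l) (F F' : D i j) (e : F = F') :
  idm G \h eqm e = eqm (congr1 (comp1 G) e).
Proof. by case: F' / e; rewrite /= hcomp_id. Qed.

Lemma whiskr_eqm i j l (G G' : D j l) (F : D i j) (e : G = G') :
  eqm e \h idm F = eqm (congr1 (fun G => comp1 G F) e).
Proof. by case: G' / e; rewrite /= hcomp_id. Qed.

Lemma pentagon i j l m n (L : D m n) (H : D l m) (G : D j l) (F : D i j) :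
  (idm L \h asc H G F) \v asc L (H \c G) F \v (asc L H G \h idm F)
  = asc L H (G \c F) \v asc (L \c H) G F.
Proof.
by rewrite /asc whiskl_eqm whiskr_eqm !eqm_trans; apply: eqm_irr.
Qed.

Lemma triangle i j l (G : D j l) (F : D i j) :
  (idm G \h lunit F) \v asc G (one j) F = runit G \h idm F.
Proof.
rewrite /asc /lunit /runit whiskl_eqm whiskr_eqm !eqm_trans; exact: eqm_irr.
Qed.

Lemma asc_lunit i j l (G : D j l) (F : D i j) :
  lunit (G \c F) \v asc (one l) G F = lunit G \h idm F.
Proof. rewrite /asc /lunit whiskr_eqm !eqm_trans; exact: eqm_irr. Qed.

Lemma asc_runit i j l (G : D j l) (F : D i j) :
  (idm G \h runit F) \v asc G F (one i) = runit (G \c F).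
Proof. rewrite /asc /runit whiskl_eqm !eqm_trans; exact: eqm_irr. Qed.

End Coherence.

Section Abel.
Variables (K : fieldType) (A : lincat K).

(* The tuple (X, k, Y_i, f_i): since Y_i = 0 for i > k, only the k indices at
   which Y_i may be nonzero are recorded.                                   *)
Record abob := AbOb {
  atop : A;
  alen : nat;
  agen : 'I_alen -> A;
  arel : forall i, hom (agen i) atop
}.
Arguments agen : clear implicits.
Arguments arel : clear implicits.

Record abraw (P Q : abob) := AbRaw {
  rtop : hom (atop P) (atop Q);
  rgen : forall i j, hom (agen P i) (agen Q j);
  rrel : forall i, rtop \v arel P i = \sum_j arel Q j \v rgen i j
}.

Definition anull (P Q : abob) (g : hom (atop P) (atop Q)) : Prop :=
  exists q : forall j, hom (atop P) (agen Q j), \sum_j arel Q j \v q j = g.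

HB.instance Definition _ P Q := gen_eqMixin (abraw P Q).
HB.instance Definition _ P Q := gen_choiceMixin (abraw P Q).

Lemma anull0 P Q : anull (0 : hom (atop P) (atop Q)).
Proof. by exists (fun=> 0); apply: big1 => j _; rewrite compm0. Qed.

Lemma anull_lin P Q a (u v : hom (atop P) (atop Q)) :
  anull u -> anull v -> anull (a *: u + v).
Proof.
move=> [q <-] [r <-]; exists (fun j => a *: q j + r j).
rewrite scaler_sumr -big_split; apply: eq_bigr => j _.
exact: comp_linr.
Qed.

Lemma anullD P Q (u v : hom (atop P) (atop Q)) :
  anull u -> anull v -> anull (u + v).
Proof. by move=> u0 /(anull_lin 1 u0); rewrite scale1r. Qed.

Lemma anullN P Q (u : hom (atop P) (atop Q)) : anull u -> anull (- u).
Proof. by move=> /(anull_lin (-1))/(_ (anull0 _ _)); rewrite scaleN1r addr0. Qed.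

Lemma anull_compr P Q R (v : hom (atop Q) (atop R)) (u : hom (atop P) (atop Q)) :
  anull v -> anull (v \v u).
Proof.
move=> [q <-]; exists (fun j => q j \v u).
by rewrite comp_suml; apply: eq_bigr => j _; rewrite compA.
Qed.

Lemma anull_compl P Q R (v : abraw Q R) (u : hom (atop P) (atop Q)) :
  anull u -> anull (rtop v \v u).
Proof.
move=> [q <-]; exists (fun l => \sum_j rgen v j l \v q j).
rewrite comp_sumr.
under eq_bigr => l _ do rewrite comp_sumr.
rewrite exchange_big; apply: eq_bigr => j _.
rewrite compA rrel comp_suml; apply: eq_bigr => l _.
by rewrite compA.
Qed.

(* A tuple (g, h) is null as soon as g factors through the relations of the
   target; h plays no role in the congruence.                               *)
Definition aequiv P Q : rel (abraw P Q) := fun u v => `[< anull (rtop u - rtop v) >].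

Lemma aequiv_refl P Q : reflexive (@aequiv P Q).
Proof. by move=> u; apply/asboolP; rewrite subrr; apply: anull0. Qed.
Lemma aequiv_sym P Q : symmetric (@aequiv P Q).
Proof.
move=> u v; apply/asboolP/asboolP => /anullN; by rewrite opprB.
Qed.
Lemma aequiv_trans P Q : transitive (@aequiv P Q).
Proof.
move=> v u w /asboolP uv /asboolP vw; apply/asboolP.
by have := anullD uv vw; rewrite addrA subrK.
Qed.

Canonical aequiv_equiv P Q :=
  EquivRel (@aequiv P Q) (@aequiv_refl P Q) (@aequiv_sym P Q) (@aequiv_trans P Q).

Definition abhom P Q : Type := {eq_quot @aequiv P Q}%qT.
HB.instance Definition _ P Q := Choice.on (abhom P Q).

Definition acls P Q (u : abraw P Q) : abhom P Q := (\pi_({eq_quot @aequiv P Q}) u)%qT.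
Definition arep P Q (x : abhom P Q) : abraw P Q := repr (x : {eq_quot @aequiv P Q}%qT).

Lemma arepK P Q (x : abhom P Q) : acls (arep x) = x.
Proof. exact: reprK. Qed.

Lemma aclsP P Q (u v : abraw P Q) : acls u = acls v <-> anull (rtop u - rtop v).
Proof. by split => [/eqmodP/asboolP|/asboolP uv] //; apply/eqmodP. Qed.

Lemma eq_acls P Q (u v : abraw P Q) : rtop u = rtop v -> acls u = acls v.
Proof. by move=> uv; apply/aclsP; rewrite uv subrr; apply: anull0. Qed.

Lemma anull_arep P Q (u : abraw P Q) : anull (rtop (arep (acls u)) - rtop u).
Proof. by apply/aclsP; rewrite arepK. Qed.

Lemma raw0_subproof P Q i :
  (0 : hom (atop P) (atop Q)) \v arel P i
  = \sum_j arel Q j \v (0 : hom (agen P i) (agen Q j)).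
Proof. by rewrite comp0m big1 // => j _; rewrite compm0. Qed.
Definition raw0 P Q := AbRaw (@raw0_subproof P Q).

Lemma raw_lin_subproof P Q a (u v : abraw P Q) i :
  (a *: rtop u + rtop v) \v arel P i
  = \sum_j arel Q j \v (a *: rgen u i j + rgen v i j).
Proof.
rewrite compDl compZl !rrel scaler_sumr -big_split; apply: eq_bigr => j _.
by rewrite compDr compZr.
Qed.
Definition raw_lin P Q a (u v : abraw P Q) := AbRaw (raw_lin_subproof a u v).

Definition ab0 P Q : abhom P Q := acls (raw0 P Q).
Definition ab_add P Q (x y : abhom P Q) : abhom P Q :=
  acls (raw_lin 1 (arep x) (arep y)).
Definition ab_opp P Q (x : abhom P Q) : abhom P Q :=
  acls (raw_lin (-1) (arep x) (raw0 P Q)).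
Definition ab_scale P Q a (x : abhom P Q) : abhom P Q :=
  acls (raw_lin a (arep x) (raw0 P Q)).

Lemma acls_ind P Q (S : abhom P Q -> Prop) :
  (forall u, S (acls u)) -> forall x, S x.
Proof. by move=> Su x; rewrite -(arepK x). Qed.

Lemma acls_lin P Q a (u v : abraw P Q) :
  acls (raw_lin a (arep (acls u)) (arep (acls v))) = acls (raw_lin a u v).
Proof.
apply/aclsP; rewrite /= opprD addrACA -scalerBr.
apply: anull_lin; exact: anull_arep.
Qed.

Lemma ab_addE P Q (u v : abraw P Q) :
  ab_add (acls u) (acls v) = acls (raw_lin 1 u v).
Proof. exact: acls_lin. Qed.

Lemma ab_scaleE P Q a (u : abraw P Q) :
  ab_scale a (acls u) = acls (raw_lin a u (raw0 P Q)).
Proof.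
apply/aclsP; rewrite /= !addr0 -scalerBr.
by have := anull_lin a (anull_arep u) (anull0 P Q); rewrite addr0.
Qed.

Lemma ab_oppE P Q (u : abraw P Q) :
  ab_opp (acls u) = acls (raw_lin (-1) u (raw0 P Q)).
Proof. exact: ab_scaleE. Qed.

Lemma ab_addA P Q : associative (@ab_add P Q).
Proof.
elim/acls_ind=> u; elim/acls_ind=> v; elim/acls_ind=> w.
by rewrite !ab_addE; apply: eq_acls; rewrite /= !scale1r addrA.
Qed.
Lemma ab_addC P Q : commutative (@ab_add P Q).
Proof.
elim/acls_ind=> u; elim/acls_ind=> v.
by rewrite !ab_addE; apply: eq_acls; rewrite /= !scale1r addrC.
Qed.
Lemma ab_add0 P Q : left_id (ab0 P Q) (@ab_add P Q).
Proof.
elim/acls_ind=> u; rewrite ab_addE; apply: eq_acls.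
by rewrite /= scaler0 add0r.
Qed.
Lemma ab_addN P Q : left_inverse (ab0 P Q) (@ab_opp P Q) (@ab_add P Q).
Proof.
elim/acls_ind=> u; rewrite ab_oppE ab_addE; apply: eq_acls.
by rewrite /= scale1r scaleN1r addr0 addNr.
Qed.

HB.instance Definition _ P Q :=
  GRing.isZmodule.Build (abhom P Q) (@ab_addA P Q) (@ab_addC P Q)
    (@ab_add0 P Q) (@ab_addN P Q).

Lemma ab_scaleA P Q a b (x : abhom P Q) :
  ab_scale a (ab_scale b x) = ab_scale (a * b) x.
Proof.
elim/acls_ind: x => u; rewrite !ab_scaleE; apply: eq_acls.
by rewrite /= !addr0 scalerA.
Qed.
Lemma ab_scale1 P Q : left_id 1 (@ab_scale P Q).
Proof.
elim/acls_ind => u; rewrite !ab_scaleE; apply: eq_acls.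
by rewrite /= !addr0 scale1r.
Qed.
Lemma ab_scaleDr P Q : right_distributive (@ab_scale P Q) +%R.
Proof.
move=> a; elim/acls_ind=> u; elim/acls_ind => v.
rewrite [_ + _]ab_addE !ab_scaleE [RHS]ab_addE; apply: eq_acls.
by rewrite /= !addr0 !scale1r scalerDr.
Qed.
Lemma ab_scaleDl P Q (x : abhom P Q) : {morph (@ab_scale P Q)^~ x : a b / a + b}.
Proof.
move=> a b; elim/acls_ind: x => u.
rewrite !ab_scaleE [RHS]ab_addE; apply: eq_acls.
by rewrite /= !addr0 !scale1r scalerDl.
Qed.

HB.instance Definition _ P Q :=
  GRing.Zmodule_isLmodule.Build K (abhom P Q) (@ab_scaleA P Q) (@ab_scale1 P Q)
    (@ab_scaleDr P Q) (@ab_scaleDl P Q).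

Lemma acls0E P Q : acls (raw0 P Q) = 0. Proof. by []. Qed.

Lemma acls_linE P Q a (u v : abraw P Q) :
  a *: acls u + acls v = acls (raw_lin a u v).
Proof.
rewrite [a *: _]ab_scaleE [LHS]ab_addE; apply: eq_acls.
by rewrite /= addr0 scale1r.
Qed.

Lemma acls_eq0 P Q (u : abraw P Q) : acls u = 0 <-> anull (rtop u).
Proof. by rewrite -acls0E aclsP /= subr0. Qed.

Definition adelta (P : abob) i j : hom (agen P i) (agen P j) :=
  match i =P j with
  | ReflectT e => eqm (congr1 (agen P) e)
  | ReflectF _ => 0
  end.

Lemma sum_adelta P i : \sum_j arel P j \v adelta i j = arel P i.
Proof.
rewrite (bigD1 i) //= big1 ?addr0.
  rewrite /adelta; case: eqP => // e.
  by rewrite eqm_id compm1.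
move=> j /eqP ji; rewrite /adelta; case: eqP => [e|_]; first by case: ji.
by rewrite compm0.
Qed.

Lemma raw_id_subproof P i :
  idm (atop P) \v arel P i = \sum_j arel P j \v adelta i j.
Proof. by rewrite comp1m sum_adelta. Qed.
Definition raw_id P := AbRaw (@raw_id_subproof P).

Lemma raw_comp_subproof P Q R (v : abraw Q R) (u : abraw P Q) i :
  (rtop v \v rtop u) \v arel P i
  = \sum_l arel R l \v \sum_j rgen v j l \v rgen u i j.
Proof.
rewrite -compA rrel comp_sumr.
under [RHS]eq_bigr => l _ do rewrite comp_sumr.
rewrite [RHS]exchange_big; apply: eq_bigr => j _ /=.
rewrite compA rrel comp_suml; apply: eq_bigr => l _.
by rewrite compA.
Qed.
Definition raw_comp P Q R (v : abraw Q R) (u : abraw P Q) : abraw P R :=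
  AbRaw (raw_comp_subproof v u).

Definition ab_id P : abhom P P := acls (raw_id P).
Definition ab_comp P Q R (y : abhom Q R) (x : abhom P Q) : abhom P R :=
  acls (raw_comp (arep y) (arep x)).

Lemma ab_compE P Q R (v : abraw Q R) (u : abraw P Q) :
  ab_comp (acls v) (acls u) = acls (raw_comp v u).
Proof.
apply/aclsP => /=.
rewrite -[X in anull X](subrKA (rtop v \v rtop (arep (acls u)))) -compBl -compBr.
apply: anullD; first exact/anull_compr/anull_arep.
exact/anull_compl/anull_arep.
Qed.

Lemma ab_comp_linl P Q R (x : abhom P Q) :
  linear (fun y : abhom Q R => ab_comp y x).
Proof.
move=> a; elim/acls_ind=> v; elim/acls_ind=> v'; elim/acls_ind: x => u.
rewrite acls_linE !ab_compE acls_linE; apply: eq_acls => /=.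
by rewrite compDl compZl.
Qed.
Lemma ab_comp_linr P Q R (y : abhom Q R) :
  linear (fun x : abhom P Q => ab_comp y x).
Proof.
move=> a; elim/acls_ind=> v; elim/acls_ind=> v'; elim/acls_ind: y => u.
rewrite acls_linE !ab_compE acls_linE; apply: eq_acls => /=.
by rewrite compDr compZr.
Qed.
Lemma ab_compA O P Q R (z : abhom Q R) (y : abhom P Q) (x : abhom O P) :
  ab_comp z (ab_comp y x) = ab_comp (ab_comp z y) x.
Proof.
elim/acls_ind: x => u; elim/acls_ind: y => v; elim/acls_ind: z => w.
by rewrite !ab_compE; apply: eq_acls => /=; rewrite compA.
Qed.
Lemma ab_comp1m P Q (x : abhom P Q) : ab_comp (ab_id Q) x = x.
Proof.
by elim/acls_ind: x => u; rewrite !ab_compE; apply: eq_acls => /=; rewrite comp1m.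
Qed.
Lemma ab_compm1 P Q (x : abhom P Q) : ab_comp x (ab_id P) = x.
Proof.
by elim/acls_ind: x => u; rewrite !ab_compE; apply: eq_acls => /=; rewrite compm1.
Qed.

Definition abelcat : lincat K :=
  @LinCat K abob (fun P Q => abhom P Q) ab_id ab_comp ab_comp_linl ab_comp_linr
    ab_compA ab_comp1m ab_compm1.

End Abel.
Arguments agen {K A} a i.
Arguments arel {K A} a i.

Section AbelEq.
Variables (K : fieldType) (A : lincat K).

Definition same_arrow (Y X Y' X' : A) (f : hom Y X) (f' : hom Y' X') : Prop :=
  exists (eX : X = X') (eY : Y = Y'), eqm eX \v f = f' \v eqm eY.

Lemma abob_eq (P Q : abob A) (en : alen P = alen Q) (et : atop P = atop Q) :
  (forall i, same_arrow (arel P i) (arel Q (cast_ord en i))) -> P = Q.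
Proof.
case: P Q en et => [X n Y f] [X' n' Y' f'] /= en et.
case: n' / en Y' f' => Y' f' same.
case: X' / et f' same => f' same.
have eY i : Y i = Y' i by case: (same i) => ? [] + _; rewrite cast_ord_id.
have {}eY : Y = Y' by apply: funext.
case: Y' / eY f' same => f' same.
congr AbOb; apply: functional_extensionality_dep => i.
have := same i; rewrite cast_ord_id => -[eX [eY]].
by rewrite !eqm_id comp1m compm1.
Qed.

Definition raw_eqm (P Q : abob A) (e : P = Q) : abraw P Q :=
  match e in _ = Q return abraw P Q with erefl => raw_id P end.

Lemma eqm_acls (P Q : abelcat A) (e : P = Q) : eqm e = acls (raw_eqm e).
Proof. by case: Q / e. Qed.

Lemma raw_eqm_top (P Q : abob A) (e : P = Q) :
  rtop (raw_eqm e) = eqm (congr1 (@atop _ _) e).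
Proof. by case: Q / e. Qed.

Lemma abel_compE (P Q R : abelcat A) (v : abraw Q R) (u : abraw P Q) :
  (acls v : hom Q R) \v (acls u : hom P Q) = acls (raw_comp v u).
Proof. exact: ab_compE. Qed.

End AbelEq.

Lemma sum_split (V : zmodType) m n (E : 'I_m + 'I_n -> V) :
  \sum_(x < m + n) E (split x) = \sum_b E (inl b) + \sum_a E (inr a).
Proof.
rewrite big_split_ord; congr (_ + _); apply: eq_bigr => x _.
  by rewrite (unsplitK (inl x)).
by rewrite (unsplitK (inr x)).
Qed.

Lemma split_l m n (b : 'I_m) : split (lshift n b) = inl b.
Proof. exact: (unsplitK (inl b)). Qed.
Lemma split_r m n (a : 'I_n) : split (rshift m a) = inr a.
Proof. exact: (unsplitK (inr a)). Qed.

Section Abel2.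
Variables (K : fieldType) (C : twocat K).

(* In the composite of (G, k, ..) and (F, k', ..) the first k' indices are
   those of F and the last k those of G.                                    *)
Section Comp1.
Variables (i j l : C) (G : abob (C j l)) (F : abob (C i j)).

Definition cgen (s : 'I_(alen F) + 'I_(alen G)) : C i l :=
  match s with
  | inl b => atop G \c agen F b
  | inr a => agen G a \c atop F
  end.

Definition crel (s : 'I_(alen F) + 'I_(alen G)) :
    hom (cgen s) (atop G \c atop F) :=
  match s with
  | inl b => idm (atop G) \h arel F b
  | inr a => arel G a \h idm (atop F)
  end.

Definition ab_comp1 : abob (C i l) := AbOb (fun x => crel (split x)).

End Comp1.

Definition ab_one i : abob (C i i) :=
  @AbOb _ (C i i) (one i) 0 (fun _ => one i) (fun _ => 0).

Section HComp.
Variables (i j l : C) (G G' : abob (C j l)) (F F' : abob (C i j)).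

Definition hgen (v : abraw G G') (u : abraw F F')
    (s : 'I_(alen F) + 'I_(alen G)) (t : 'I_(alen F') + 'I_(alen G')) :
    hom (cgen s) (cgen t) :=
  match s, t with
  | inl b, inl b' => rtop v \h rgen u b b'
  | inr a, inr a' => rgen v a a' \h rtop u
  | _, _ => 0
  end.

Lemma raw_hcomp_subproof (v : abraw G G') (u : abraw F F')
    (x : 'I_(alen F + alen G)) :
  (rtop v \h rtop u) \v crel (split x)
  = \sum_y crel (split y) \v hgen v u (split x) (split y).
Proof.
rewrite (sum_split (fun t => crel t \v hgen v u (split x) t)).
case: (split x) => [b|a] /=.
  rewrite [X in _ = _ + X]big1 ?addr0; last by move=> a _; rewrite compm0.
  rewrite -interchange compm1 rrel hcomp_sumr; apply: eq_bigr => b' _.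
  by rewrite -interchange comp1m.
rewrite [X in _ = X + _]big1 ?add0r; last by move=> b _; rewrite compm0.
rewrite -interchange compm1 rrel hcomp_suml; apply: eq_bigr => a' _.
by rewrite -interchange comp1m.
Qed.

Definition raw_hcomp (v : abraw G G') (u : abraw F F') :
    abraw (ab_comp1 G F) (ab_comp1 G' F') :=
  @AbRaw _ _ (ab_comp1 G F) (ab_comp1 G' F') (rtop v \h rtop u)
    (fun x y => hgen v u (split x) (split y)) (raw_hcomp_subproof v u).

Definition ab_hcomp (y : abhom G G') (x : abhom F F') :
    abhom (ab_comp1 G F) (ab_comp1 G' F') :=
  acls (raw_hcomp (arep y) (arep x)).

Lemma anull_hcompl (v : hom (atop G) (atop G')) (u : abraw F F') :
  @anull _ _ G G' v -> @anull _ _ (ab_comp1 G F) (ab_comp1 G' F') (v \h rtop u).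
Proof.
move=> [q <-].
pose r (t : 'I_(alen F') + 'I_(alen G')) : hom (atop G \c atop F) (cgen t) :=
  match t with
  | inl b => 0
  | inr a => q a \h rtop u
  end.
exists (fun y => r (split y)).
rewrite (sum_split (fun t => crel t \v r t)) /=.
rewrite big1 ?add0r; last by move=> b _; rewrite compm0.
rewrite hcomp_suml; apply: eq_bigr => a _.
by rewrite -interchange comp1m.
Qed.

Lemma anull_hcompr (v : abraw G G') (u : hom (atop F) (atop F')) :
  @anull _ _ F F' u -> @anull _ _ (ab_comp1 G F) (ab_comp1 G' F') (rtop v \h u).
Proof.
move=> [q <-].
pose r (t : 'I_(alen F') + 'I_(alen G')) : hom (atop G \c atop F) (cgen t) :=
  match t with
  | inl b => rtop v \h q b
  | inr a => 0
  end.
exists (fun y => r (split y)).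
rewrite (sum_split (fun t => crel t \v r t)) /=.
rewrite [X in _ + X]big1 ?addr0; last by move=> b _; rewrite compm0.
rewrite hcomp_sumr; apply: eq_bigr => b _.
by rewrite -interchange comp1m.
Qed.

Lemma ab_hcompE (v : abraw G G') (u : abraw F F') :
  ab_hcomp (acls v) (acls u) = acls (raw_hcomp v u).
Proof.
apply/aclsP => /=.
rewrite -[X in anull X](subrKA (rtop v \h rtop (arep (acls u)))).
rewrite -hcompBl -hcompBr.
apply: anullD; first exact/anull_hcompl/anull_arep.
exact/anull_hcompr/anull_arep.
Qed.

Lemma ab_hcomp_linl (x : abhom F F') :
  linear (fun y : abhom G G' => ab_hcomp y x).
Proof.
move=> a; elim/acls_ind=> v; elim/acls_ind=> v'; elim/acls_ind: x => u.
rewrite acls_linE !ab_hcompE acls_linE; apply: eq_acls => /=.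
by rewrite hcompDl hcompZl.
Qed.

Lemma ab_hcomp_linr (y : abhom G G') :
  linear (fun x : abhom F F' => ab_hcomp y x).
Proof.
move=> a; elim/acls_ind=> u; elim/acls_ind=> u'; elim/acls_ind: y => v.
rewrite acls_linE !ab_hcompE acls_linE; apply: eq_acls => /=.
by rewrite hcompDr hcompZr.
Qed.

End HComp.

Lemma ab_hcomp_id i j l (G : abob (C j l)) (F : abob (C i j)) :
  ab_hcomp (ab_id G) (ab_id F) = ab_id (ab_comp1 G F).
Proof. by rewrite ab_hcompE; apply: eq_acls; rewrite /= hcomp_id. Qed.

Lemma ab_interchange i j l (G G' G'' : abob (C j l)) (F F' F'' : abob (C i j))
    (y' : abhom G' G'') (y : abhom G G') (x' : abhom F' F'') (x : abhom F F') :
  ab_hcomp (ab_comp y' y) (ab_comp x' x)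
  = ab_comp (ab_hcomp y' x') (ab_hcomp y x).
Proof.
elim/acls_ind: x => u; elim/acls_ind: x' => u'.
elim/acls_ind: y => v; elim/acls_ind: y' => v'.
rewrite [ab_comp (acls v') _]ab_compE [ab_comp (acls u') _]ab_compE.
rewrite !ab_hcompE ab_compE; apply: eq_acls.
exact: interchange.
Qed.

Lemma ab_comp1A i j l m (H : abob (C l m)) (G : abob (C j l))
    (F : abob (C i j)) :
  ab_comp1 (ab_comp1 H G) F = ab_comp1 H (ab_comp1 G F).
Proof.
pose P := ab_comp1 (ab_comp1 H G) F; pose Q := ab_comp1 H (ab_comp1 G F).
have en : alen P = alen Q := addnA (alen F) (alen G) (alen H).
apply: (@abob_eq _ _ P Q en (comp1A _ _ _)) => x /=.
case: (split_ordP x) => [b ->|y ->].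
  have -> : cast_ord en (lshift (alen G + alen H) b)
     = lshift (alen H) (lshift (alen G) b) by apply: val_inj.
  rewrite ?split_l /= ?split_l /=.
  exists (comp1A _ _ _), (comp1A _ _ _).
  by rewrite -hcomp_id hcompA.
case: (split_ordP y) => [a ->|c ->].
  have -> : cast_ord en (rshift (alen F) (lshift (alen H) a))
     = lshift (alen H) (rshift (alen F) a) by apply: val_inj.
  rewrite ?(split_l, split_r) /= ?(split_l, split_r) /=.
  exists (comp1A _ _ _), (comp1A _ _ _).
  by rewrite hcompA.
have -> : cast_ord en (rshift (alen F) (rshift (alen G) c))
   = rshift (alen F + alen G) c by apply: val_inj; rewrite /= addnA.
rewrite ?split_r /= ?split_r /=.
exists (comp1A _ _ _), (comp1A _ _ _).
by rewrite -hcomp_id hcompA.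
Qed.

Lemma ab_comp1f i j (F : abob (C i j)) : ab_comp1 (ab_one j) F = F.
Proof.
apply: (@abob_eq _ _ (ab_comp1 (ab_one j) F) F (addn0 _) (comp1f _)) => x /=.
case: (split_ordP x) => [b ->|[]//].
have -> : cast_ord (addn0 _) (lshift 0 b) = b by apply: val_inj.
move=> /=.
exists (comp1f _), (comp1f _).
by rewrite hcomp1m.
Qed.

Lemma ab_compf1 i j (F : abob (C i j)) : ab_comp1 F (ab_one i) = F.
Proof.
apply: (@abob_eq _ _ (ab_comp1 F (ab_one i)) F (add0n _) (compf1 _)) => x /=.
case: (split_ordP x) => [[]//|a ->].
have -> : cast_ord (add0n _) (rshift 0 a) = a by apply: val_inj.
move=> /=.
exists (compf1 _), (compf1 _).
by rewrite hcompm1.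
Qed.

Lemma ab_hcompA i j l m (H H' : abelcat (C l m)) (G G' : abelcat (C j l))
    (F F' : abelcat (C i j)) (z : hom H H') (y : hom G G') (x : hom F F') :
  (eqm (ab_comp1A H' G' F' : _ = _ :> abelcat _)
     : hom (ab_comp1 (ab_comp1 H' G') F' : abelcat _) _)
    \v ab_hcomp (ab_hcomp z y) x
  = (ab_hcomp z (ab_hcomp y x) : hom (_ : abelcat _) _)
    \v (eqm (ab_comp1A H G F : _ = _ :> abelcat _)).
Proof.
elim/acls_ind: x => u; elim/acls_ind: y => v; elim/acls_ind: z => w.
rewrite !eqm_acls !ab_hcompE !abel_compE; apply: eq_acls.
rewrite /= !raw_eqm_top.
move: (congr1 _ _) => e; move: (congr1 _ _) => e'.
rewrite (Prop_irrelevance e (comp1A _ _ _)) (Prop_irrelevance e' (comp1A _ _ _)).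
exact: hcompA.
Qed.

Lemma ab_hcomp1m i j (F F' : abelcat (C i j)) (x : hom F F') :
  eqm (ab_comp1f F' : _ = _ :> abelcat _)
    \v (ab_hcomp (ab_id (ab_one j)) x : hom (_ : abelcat _) (_ : abelcat _))
  = x \v (eqm (ab_comp1f F : _ = _ :> abelcat _)).
Proof.
elim/acls_ind: x => u.
rewrite !eqm_acls !ab_hcompE !abel_compE; apply: eq_acls.
rewrite /= !raw_eqm_top.
move: (congr1 _ _) => e; move: (congr1 _ _) => e'.
rewrite (Prop_irrelevance e (comp1f _)) (Prop_irrelevance e' (comp1f _)).
exact: hcomp1m.
Qed.

Lemma ab_hcompm1 i j (F F' : abelcat (C i j)) (x : hom F F') :
  eqm (ab_compf1 F' : _ = _ :> abelcat _)
    \v (ab_hcomp x (ab_id (ab_one i)) : hom (_ : abelcat _) (_ : abelcat _))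
  = x \v (eqm (ab_compf1 F : _ = _ :> abelcat _)).
Proof.
elim/acls_ind: x => u.
rewrite !eqm_acls !ab_hcompE !abel_compE; apply: eq_acls.
rewrite /= !raw_eqm_top.
move: (congr1 _ _) => e; move: (congr1 _ _) => e'.
rewrite (Prop_irrelevance e (compf1 _)) (Prop_irrelevance e' (compf1 _)).
exact: hcompm1.
Qed.

Definition abel : twocat K :=
  @TwoCat K (obj C) (fun i j => abelcat (C i j)) ab_one ab_comp1 ab_hcomp
    ab_hcomp_linl ab_hcomp_linr ab_hcomp_id ab_interchange
    ab_comp1A ab_comp1f ab_compf1 ab_hcompA ab_hcomp1m ab_hcompm1.

End Abel2.

(* A choice of cokernels, and right exactness of composition on both sides: this
   is what makes the actions descend to the tensor product over an algebra.   *)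
Record right_exact (K : fieldType) (D : twocat K) := RightExact {
  coker : forall (i j : D) (F G : D i j), hom F G -> D i j;
  coker_pi : forall (i j : D) (F G : D i j) (f : hom F G), hom G (coker f);
  cokerP : forall (i j : D) (F G : D i j) (f : hom F G),
    is_coker f (coker_pi f);
  coker_whiskl : forall (i j l : D) (H : D j l) (F G Q : D i j) (f : hom F G)
    (p : hom G Q), is_coker f p -> is_coker (idm H \h f) (idm H \h p);
  coker_whiskr : forall (i j l : D) (F G Q : D j l) (f : hom F G)
    (p : hom G Q) (H : D i j), is_coker f p -> is_coker (f \h idm H) (p \h idm H)
}.

Section CokerIso.
Variables (K : fieldType) (A : lincat K).

Lemma coker_isoP (X Y Q Q' : A) (f : hom X Y) (p : hom Y Q) (p' : hom Y Q') :
  is_coker f p -> is_coker f p' -> exists t : hom Q Q', is_iso t /\ t \v p = p'.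
Proof.
move=> cp cp'; exists (desc cp cp'.1); split; last exact: descE.
exists (desc cp' cp.1); split.
  by apply: (coker_epi cp); rewrite -compA !descE comp1m.
by apply: (coker_epi cp'); rewrite -compA !descE comp1m.
Qed.

Lemma coker_iso_comp (X Y Q Q' : A) (f : hom X Y) (p : hom Y Q) (t : hom Q Q') :
  is_coker f p -> is_iso t -> is_coker f (t \v p).
Proof.
move=> cp [s [st ts]]; split; first by rewrite -compA cp.1 compm0.
move=> R u uf; exists (desc cp uf \v s); split.
  by rewrite -compA (compA s) st comp1m descE.
move=> v' v'p; rewrite -[LHS]compm1 -ts compA; congr (_ \v _).
by apply: (coker_epi cp); rewrite descE -compA.
Qed.

End CokerIso.

Section AbelCoker.
Variables (K : fieldType) (A : lincat K).

Lemma abraw_exists (P Q : abob A) (g : hom (atop P) (atop Q)) :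
  (forall x, exists h : forall y, hom (agen P x) (agen Q y),
     g \v arel P x = \sum_y arel Q y \v h y) ->
  exists w : abraw P Q, rtop w = g.
Proof.
by move=> ex; exists (AbRaw (fun x => svalP (cid (ex x)))).
Qed.

Section Criterion.
Variables (P Q : abob A) (f : abraw P Q).
Variables (n : nat) (gen : 'I_n -> A) (rel : forall t, hom (gen t) (atop Q)).
Let T : abob A := AbOb rel.

Lemma coker_criterion (p : abraw Q T) :
  rtop p = idm (atop Q) ->
  @anull _ _ P T (rtop f) ->
  (forall t, (exists a : hom (gen t) (atop P), rel t = rtop f \v a) \/
     exists x (c : hom (gen t) (agen Q x)), rel t = arel Q x \v c) ->
  is_coker (acls f : hom (P : abelcat A) Q) (acls p : hom (Q : abelcat A) T).
Proof.
move=> p1 f0 relP; split.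
  by rewrite abel_compE; apply/acls_eq0; rewrite /= p1 comp1m.
move=> R; elim/acls_ind => v; rewrite abel_compE => /acls_eq0 [q /= vf].
have [w /= wv] : exists w : abraw T R, rtop w = rtop v.
  apply: abraw_exists => /= t.
  have [[a ->]|[x [c ->]]] := relP t.
    exists (fun y => q y \v a); rewrite compA -vf comp_suml.
    by apply: eq_bigr => y _; rewrite compA.
  exists (fun y => rgen v x y \v c); rewrite compA rrel comp_suml.
  by apply: eq_bigr => y _; rewrite compA.
exists (acls w); split.
  by rewrite [LHS]ab_compE; apply: eq_acls; rewrite /= p1 compm1.
elim/acls_ind => w'; rewrite [X in X = _ -> _]ab_compE => /aclsP; rewrite /= p1 compm1 -wv.
by move=> w'w; apply/aclsP.
Qed.

End Criterion.

Section Explicit.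
Variables (P Q : abob A) (f : abhom P Q).

Definition kgen (s : 'I_(alen Q) + 'I_1) : A :=
  match s with inl x => agen Q x | inr _ => atop P end.

Definition krel (s : 'I_(alen Q) + 'I_1) : hom (kgen s) (atop Q) :=
  match s with inl x => arel Q x | inr _ => rtop (arep f) end.

(* The relations of Q together with one more, given by f itself. *)
Definition ab_coker : abob A := AbOb (fun t => krel (split t)).

Definition kdelta x (s : 'I_(alen Q) + 'I_1) : hom (agen Q x) (kgen s) :=
  match s with inl y => adelta x y | inr _ => 0 end.

Lemma raw_coker_subproof x :
  idm (atop Q) \v arel Q x = \sum_t krel (split t) \v kdelta x (split t).
Proof.
rewrite (sum_split (fun s => krel s \v kdelta x s)) /=.
rewrite [X in _ + X]big1 ?addr0; last by move=> y _; rewrite compm0.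
by rewrite comp1m sum_adelta.
Qed.
Definition raw_coker : abraw Q ab_coker :=
  @AbRaw _ _ Q ab_coker (idm (atop Q)) (fun x t => kdelta x (split t))
    raw_coker_subproof.

Lemma anull_coker : @anull _ _ P ab_coker (rtop (arep f)).
Proof.
pose q (s : 'I_(alen Q) + 'I_1) : hom (atop P) (kgen s) :=
  match s with inl _ => 0 | inr _ => idm (atop P) end.
exists (fun t => q (split t)).
rewrite (sum_split (fun s => krel s \v q s)) /= big1 ?add0r.
  by rewrite big_ord1 compm1.
by move=> x _; rewrite compm0.
Qed.

End Explicit.
End AbelCoker.

Section AbelRex.
Variables (K : fieldType) (C : twocat K).

Definition abel_coker (i j : abel C) (F G : abel C i j) (f : hom F G) :
  abel C i j := ab_coker f.
Definition abel_coker_pi (i j : abel C) (F G : abel C i j) (f : hom F G) :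
  hom G (abel_coker f) := acls (raw_coker f).

Lemma abel_hcompE (i j l : abel C) (G G' : abel C j l) (F F' : abel C i j)
    (v : abraw G G') (u : abraw F F') :
  (acls v : hom G G') \h (acls u : hom F F') = acls (raw_hcomp v u).
Proof. exact: ab_hcompE. Qed.

Lemma abel_cokerP (i j : abel C) (F G : abel C i j) (f : hom F G) :
  is_coker f (abel_coker_pi f).
Proof.
rewrite -{1}(arepK f); apply: coker_criterion => //=.
  exact: anull_coker.
move=> t; case: (split t) => [x|_] /=.
  by right; exists x, (idm _); rewrite compm1.
by left; exists (idm _); rewrite compm1.
Qed.

Lemma crel_split (i j l : C) (G : abob (C j l)) (F : abob (C i j))
    (s : 'I_(alen F) + 'I_(alen G)) :
  exists x (c : hom (cgen s) (agen (ab_comp1 G F) x)),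
    crel s = arel (ab_comp1 G F) x \v c.
Proof.
exists (unsplit s), (eqm (congr1 (@cgen _ _ _ _ _ G F) (esym (unsplitK s)))).
rewrite /=; case: _ / (esym (unsplitK s)); by rewrite /= compm1.
Qed.

Lemma abel_coker_whiskl0 (i j l : abel C) (H : abel C j l) (F G : abel C i j)
    (f : hom F G) :
  is_coker (idm H \h f) (idm H \h abel_coker_pi f).
Proof.
rewrite -{1}(arepK f) !abel_hcompE; apply: coker_criterion => /=.
- exact: hcomp_id.
- apply: (@anull_hcompr _ _ _ _ _ H H F (ab_coker f) (raw_id H)).
  exact: anull_coker.
move=> t; case: (split t) => [y|a] /=; last first.
  by right; apply: (crel_split (inr a)).
case: (split y) => [x|_] /=; first by right; apply: (crel_split (inl x)).
by left; exists (idm _); rewrite compm1.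
Qed.

Lemma abel_coker_whiskr0 (i j l : abel C) (F G : abel C j l) (f : hom F G)
    (H : abel C i j) :
  is_coker (f \h idm H) (abel_coker_pi f \h idm H).
Proof.
rewrite -{1}(arepK f) !abel_hcompE; apply: coker_criterion => /=.
- exact: hcomp_id.
- apply: (@anull_hcompl _ _ _ _ _ F (ab_coker f) H H _ (raw_id H)).
  exact: anull_coker.
move=> t; case: (split t) => [b|y] /=.
  by right; apply: (@crel_split _ _ _ G H (inl b)).
case: (split y) => [x|_] /=; last by left; exists (idm _); rewrite compm1.
by right; apply: (@crel_split _ _ _ G H (inr x)).
Qed.

Lemma abel_coker_whiskl (i j l : abel C) (H : abel C j l)
    (F G Q : abel C i j) (f : hom F G) (p : hom G Q) :
  is_coker f p -> is_coker (idm H \h f) (idm H \h p).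
Proof.
move=> cp; have [t [[s [st ts]] <-]] := coker_isoP (abel_cokerP f) cp.
rewrite -whiskl_comp; apply: coker_iso_comp; first exact: abel_coker_whiskl0.
by exists (idm H \h s); rewrite !whiskl_comp st ts !hcomp_id.
Qed.

Lemma abel_coker_whiskr (i j l : abel C) (F G Q : abel C j l) (f : hom F G)
    (p : hom G Q) (H : abel C i j) :
  is_coker f p -> is_coker (f \h idm H) (p \h idm H).
Proof.
move=> cp; have [t [[s [st ts]] <-]] := coker_isoP (abel_cokerP f) cp.
rewrite -whiskr_comp; apply: coker_iso_comp; first exact: abel_coker_whiskr0.
by exists (s \h idm H); rewrite !whiskr_comp st ts !hcomp_id.
Qed.

Definition abel_rex : right_exact (abel C) :=
  RightExact abel_cokerP abel_coker_whiskl abel_coker_whiskr.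

End AbelRex.

Record algebra (K : fieldType) (D : twocat K) (i : D) := Algebra {
  alg_car :> D i i;
  alg_mul : hom (alg_car \c alg_car) alg_car;
  alg_unit : hom (one i) alg_car;
  alg_mulA : alg_mul \v (alg_mul \h idm alg_car)
    = alg_mul \v (idm alg_car \h alg_mul) \v asc alg_car alg_car alg_car;
  alg_mul1m : alg_mul \v (alg_unit \h idm alg_car) = lunit alg_car;
  alg_mulm1 : alg_mul \v (idm alg_car \h alg_unit) = runit alg_car
}.

Record rmodule (K : fieldType) (D : twocat K) (i : D) (A : algebra i) (j : D)
  := RModule {
  rm_car :> D i j;
  rm_act : hom (rm_car \c A) rm_car;
  rm_actA : rm_act \v (rm_act \h idm A)
    = rm_act \v (idm rm_car \h alg_mul A) \v asc rm_car A A;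
  rm_act1 : rm_act \v (idm rm_car \h alg_unit A) = runit rm_car
}.

Record lmodule (K : fieldType) (D : twocat K) (i : D) (A : algebra i) (j : D)
  := LModule {
  lm_car :> D j i;
  lm_act : hom (A \c lm_car) lm_car;
  lm_actA : lm_act \v (alg_mul A \h idm lm_car)
    = lm_act \v (idm A \h lm_act) \v asc A A lm_car;
  lm_act1 : lm_act \v (alg_unit A \h idm lm_car) = lunit lm_car
}.

Record bimodule (K : fieldType) (D : twocat K) (i j : D) (A : algebra i)
  (B : algebra j) := Bimodule {
  bm_car :> D j i;
  bm_l : hom (A \c bm_car) bm_car;
  bm_r : hom (bm_car \c B) bm_car;
  bm_lA : bm_l \v (alg_mul A \h idm bm_car)
    = bm_l \v (idm A \h bm_l) \v asc A A bm_car;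
  bm_l1 : bm_l \v (alg_unit A \h idm bm_car) = lunit bm_car;
  bm_rA : bm_r \v (bm_r \h idm B)
    = bm_r \v (idm bm_car \h alg_mul B) \v asc bm_car B B;
  bm_r1 : bm_r \v (idm bm_car \h alg_unit B) = runit bm_car;
  bm_lr : bm_r \v (bm_l \h idm B)
    = bm_l \v (idm A \h bm_r) \v asc A bm_car B
}.

Section Modules.
Variables (K : fieldType) (D : twocat K).

Definition bm_lmodule (i j : D) (A : algebra i) (B : algebra j)
  (M : bimodule A B) : lmodule A j := LModule (bm_lA M) (bm_l1 M).

Definition bm_rmodule (i j : D) (A : algebra i) (B : algebra j)
  (M : bimodule A B) : rmodule B i := RModule (bm_rA M) (bm_r1 M).

Section RModCat.
Variables (i : D) (A : algebra i) (j : D).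
Implicit Types X Y Z : rmodule A j.

Definition rlin X Y : {pred hom X Y} :=
  [pred u | rm_act Y \v (u \h idm A) == u \v rm_act X].
Arguments rlin : clear implicits.

Lemma rlin_submod X Y : submod_closed (rlin X Y).
Proof.
split; first by rewrite inE hcomp0m compm0 comp0m.
move=> a u v /eqP uA /eqP vA; rewrite inE.
by rewrite hcompDl hcompZl compDr compZr uA vA compDl compZl.
Qed.
HB.instance Definition _ X Y :=
  GRing.isSubmodClosed.Build K (hom X Y) (rlin X Y) (rlin_submod X Y).

Record rmodhom X Y := RModHom {
  rmodhom_val :> hom X Y;
  rmodhomP : rmodhom_val \in rlin X Y
}.
HB.instance Definition _ X Y := [isSub for @rmodhom_val X Y].
HB.instance Definition _ X Y := [Choice of rmodhom X Y by <:].
HB.instance Definition _ X Y := [SubChoice_isSubLmodule of rmodhom X Y by <:].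

Lemma rmodhomE X Y (u : rmodhom X Y) :
  rm_act Y \v (u \h idm A) = rmodhom_val u \v rm_act X.
Proof. exact/eqP/rmodhomP. Qed.

Lemma rlin_id X : idm (X : D i j) \in rlin X X.
Proof. by rewrite inE hcomp_id compm1 comp1m. Qed.
Definition rmod_id X : rmodhom X X := RModHom (rlin_id X).

Lemma rlin_comp X Y Z (v : rmodhom Y Z) (u : rmodhom X Y) :
  rmodhom_val v \v rmodhom_val u \in rlin X Z.
Proof.
by rewrite inE -whiskr_comp compA rmodhomE -compA rmodhomE compA.
Qed.
Definition rmod_comp X Y Z (v : rmodhom Y Z) (u : rmodhom X Y) : rmodhom X Z :=
  RModHom (rlin_comp v u).

Lemma rmod_comp_linl X Y Z (u : rmodhom X Y) :
  linear (fun v : rmodhom Y Z => rmod_comp v u).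
Proof. by move=> a v w; apply: val_inj; apply: comp_linl. Qed.
Lemma rmod_comp_linr X Y Z (v : rmodhom Y Z) :
  linear (fun u : rmodhom X Y => rmod_comp v u).
Proof. by move=> a u w; apply: val_inj; apply: comp_linr. Qed.
Lemma rmod_compA W X Y Z (w : rmodhom Y Z) (v : rmodhom X Y) (u : rmodhom W X) :
  rmod_comp w (rmod_comp v u) = rmod_comp (rmod_comp w v) u.
Proof. by apply: val_inj; apply: compA. Qed.
Lemma rmod_comp1m X Y (u : rmodhom X Y) : rmod_comp (rmod_id Y) u = u.
Proof. by apply: val_inj; apply: comp1m. Qed.
Lemma rmod_compm1 X Y (u : rmodhom X Y) : rmod_comp u (rmod_id X) = u.
Proof. by apply: val_inj; apply: compm1. Qed.

Definition rmodcat : lincat K :=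
  @LinCat K (rmodule A j) (fun X Y => rmodhom X Y) rmod_id rmod_comp
    rmod_comp_linl rmod_comp_linr rmod_compA rmod_comp1m rmod_compm1.

Lemma rmodule_eq X Y (e : rm_car X = rm_car Y) :
  rm_act Y \v (eqm e \h idm A) = eqm e \v rm_act X -> X = Y.
Proof.
case: X Y e => [X x xA x1] [Y y yA y1] /= e.
case: Y / e y yA y1 => y yA y1 /=; rewrite hcomp_id comp1m compm1 => e.
case: x / e xA x1 => xA x1.
by rewrite (Prop_irrelevance xA yA) (Prop_irrelevance x1 y1).
Qed.

Lemma rmodcat_eqm (X Y : rmodcat) (e : X = Y) :
  rmodhom_val (eqm e : hom X Y) = eqm (congr1 (@rm_car _ _ _ A j) e).
Proof. by case: Y / e. Qed.

End RModCat.

Section LModCat.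
Variables (i : D) (A : algebra i) (j : D).
Implicit Types X Y Z : lmodule A j.

Definition llin X Y : {pred hom X Y} :=
  [pred u | lm_act Y \v (idm A \h u) == u \v lm_act X].
Arguments llin : clear implicits.

Lemma llin_submod X Y : submod_closed (llin X Y).
Proof.
split; first by rewrite inE hcompm0 compm0 comp0m.
move=> a u v /eqP uA /eqP vA; rewrite inE.
by rewrite hcompDr hcompZr compDr compZr uA vA compDl compZl.
Qed.
HB.instance Definition _ X Y :=
  GRing.isSubmodClosed.Build K (hom X Y) (llin X Y) (llin_submod X Y).

Record lmodhom X Y := LModHom {
  lmodhom_val :> hom X Y;
  lmodhomP : lmodhom_val \in llin X Y
}.
HB.instance Definition _ X Y := [isSub for @lmodhom_val X Y].
HB.instance Definition _ X Y := [Choice of lmodhom X Y by <:].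
HB.instance Definition _ X Y := [SubChoice_isSubLmodule of lmodhom X Y by <:].

Lemma lmodhomE X Y (u : lmodhom X Y) :
  lm_act Y \v (idm A \h u) = lmodhom_val u \v lm_act X.
Proof. exact/eqP/lmodhomP. Qed.

Lemma llin_id X : idm (X : D j i) \in llin X X.
Proof. by rewrite inE hcomp_id compm1 comp1m. Qed.
Definition lmod_id X : lmodhom X X := LModHom (llin_id X).

Lemma llin_comp X Y Z (v : lmodhom Y Z) (u : lmodhom X Y) :
  lmodhom_val v \v lmodhom_val u \in llin X Z.
Proof.
by rewrite inE -whiskl_comp compA lmodhomE -compA lmodhomE compA.
Qed.
Definition lmod_comp X Y Z (v : lmodhom Y Z) (u : lmodhom X Y) : lmodhom X Z :=
  LModHom (llin_comp v u).

Lemma lmod_comp_linl X Y Z (u : lmodhom X Y) :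
  linear (fun v : lmodhom Y Z => lmod_comp v u).
Proof. by move=> a v w; apply: val_inj; apply: comp_linl. Qed.
Lemma lmod_comp_linr X Y Z (v : lmodhom Y Z) :
  linear (fun u : lmodhom X Y => lmod_comp v u).
Proof. by move=> a u w; apply: val_inj; apply: comp_linr. Qed.
Lemma lmod_compA W X Y Z (w : lmodhom Y Z) (v : lmodhom X Y) (u : lmodhom W X) :
  lmod_comp w (lmod_comp v u) = lmod_comp (lmod_comp w v) u.
Proof. by apply: val_inj; apply: compA. Qed.
Lemma lmod_comp1m X Y (u : lmodhom X Y) : lmod_comp (lmod_id Y) u = u.
Proof. by apply: val_inj; apply: comp1m. Qed.
Lemma lmod_compm1 X Y (u : lmodhom X Y) : lmod_comp u (lmod_id X) = u.
Proof. by apply: val_inj; apply: compm1. Qed.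

Definition lmodcat : lincat K :=
  @LinCat K (lmodule A j) (fun X Y => lmodhom X Y) lmod_id lmod_comp
    lmod_comp_linl lmod_comp_linr lmod_compA lmod_comp1m lmod_compm1.

End LModCat.

Definition biprojective (i j : D) (A : algebra i) (B : algebra j)
    (M : bimodule A B) : Prop :=
  projective (bm_lmodule M : lmodcat A j) /\
  projective (bm_rmodule M : rmodcat B i).

End Modules.
Arguments rlin {K D i A j} X Y.
Arguments llin {K D i A j} X Y.

Record linfunctor (K : fieldType) (A B : lincat K) := LinFunctor {
  fob :> A -> B;
  fmap : forall X Y : A, hom X Y -> hom (fob X) (fob Y);
  fmap_lin : forall X Y : A, linear (@fmap X Y);
  fmap_id : forall X : A, fmap (idm X) = idm (fob X);
  fmap_comp : forall (X Y Z : A) (g : hom Y Z) (f : hom X Y),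
    fmap (g \v f) = fmap g \v fmap f
}.
Arguments fmap {K A B} l {X Y} f.

Definition equivalence (K : fieldType) (A B : lincat K)
    (F : linfunctor A B) : Prop :=
  exists G : linfunctor B A,
  (exists eta : forall X : A, hom X (G (F X)),
     (forall X, is_iso (eta X)) /\
     forall (X Y : A) (f : hom X Y), eta Y \v f = fmap G (fmap F f) \v eta X) /\
  (exists eps : forall Y : B, hom (F (G Y)) Y,
     (forall Y, is_iso (eps Y)) /\
     forall (X Y : B) (f : hom X Y), eps Y \v fmap F (fmap G f) = f \v eps X).

(* A 2-functor from D to linear categories. The functor rep1 F : M(i) -> M(j)
   of a 1-morphism F and the natural transformations of 2-morphisms are given
   jointly by rep2: the functor acts on morphisms by rep2 (idm F), and the
   transformation attached to a has components rep2 a (idm X).              *)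
Record tworep (K : fieldType) (D : twocat K) := TwoRep {
  rep0 :> D -> lincat K;
  rep1 : forall i j : D, D i j -> rep0 i -> rep0 j;
  rep2 : forall (i j : D) (F G : D i j) (X Y : rep0 i),
    hom F G -> hom X Y -> hom (rep1 F X) (rep1 G Y);
  rep2_linl : forall (i j : D) (F G : D i j) (X Y : rep0 i) (u : hom X Y),
    linear (fun a : hom F G => rep2 a u);
  rep2_linr : forall (i j : D) (F G : D i j) (X Y : rep0 i) (a : hom F G),
    linear (fun u : hom X Y => rep2 a u);
  rep2_id : forall (i j : D) (F : D i j) (X : rep0 i),
    rep2 (idm F) (idm X) = idm (rep1 F X);
  rep2_comp : forall (i j : D) (F G H : D i j) (X Y Z : rep0 i)
    (b : hom G H) (a : hom F G) (v : hom Y Z) (u : hom X Y),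
    rep2 (b \v a) (v \v u) = rep2 b v \v rep2 a u;
  rep1_comp : forall (i j l : D) (G : D j l) (F : D i j) (X : rep0 i),
    rep1 (G \c F) X = rep1 G (rep1 F X);
  rep1_one : forall (i : D) (X : rep0 i), rep1 (one i) X = X;
  rep2_hcomp : forall (i j l : D) (G G' : D j l) (F F' : D i j)
    (X Y : rep0 i) (b : hom G G') (a : hom F F') (u : hom X Y),
    eqm (rep1_comp G' F' Y) \v rep2 (b \h a) u
      = rep2 b (rep2 a u) \v eqm (rep1_comp G F X);
  rep2_one : forall (i : D) (X Y : rep0 i) (u : hom X Y),
    eqm (rep1_one Y) \v rep2 (idm (one i)) u = u \v eqm (rep1_one X)
}.
Arguments rep1 {K D} t {i j} F X.
Arguments rep2 {K D} t {i j F G X Y} a u.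

Record tworep_mor (K : fieldType) (D : twocat K) (M N : tworep D) :=
  TwoRepMor {
  trm_fun :> forall i : D, linfunctor (M i) (N i);
  trm_iso : forall (i j : D) (F : D i j) (X : M i),
    hom (trm_fun j (rep1 M F X)) (rep1 N F (trm_fun i X));
  trm_isoP : forall (i j : D) (F : D i j) (X : M i), is_iso (trm_iso F X);
  trm_nat : forall (i j : D) (F G : D i j) (X Y : M i) (a : hom F G)
    (u : hom X Y),
    trm_iso G Y \v fmap (trm_fun j) (rep2 M a u)
      = rep2 N a (fmap (trm_fun i) u) \v trm_iso F X;
  trm_comp : forall (i j l : D) (G : D j l) (F : D i j) (X : M i),
    eqm (rep1_comp G F (trm_fun i X)) \v trm_iso (G \c F) X
      = rep2 N (idm G) (trm_iso F X) \v trm_iso G (rep1 M F X)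
          \v fmap (trm_fun l) (eqm (rep1_comp G F X));
  trm_one : forall (i : D) (X : M i),
    eqm (rep1_one (trm_fun i X)) \v trm_iso (one i) X
      = fmap (trm_fun i) (eqm (rep1_one X))
}.

Definition tworep_equivalent (K : fieldType) (D : twocat K)
    (M N : tworep D) : Prop :=
  exists Phi : tworep_mor M N, forall i : D, equivalence (Phi i).

Section ModRep.
Variables (K : fieldType) (D : twocat K) (i : D) (A : algebra i).

Section Act.
Variables (j l : D) (F : D j l) (X : rmodule A j).

Definition mr_act : hom ((F \c X) \c A) (F \c X) :=
  (idm F \h rm_act X) \v asc F X A.

Lemma mr_actA : mr_act \v (mr_act \h idm A)
  = mr_act \v (idm (F \c X) \h alg_mul A) \v asc (F \c X) A A.
Proof.
rewrite /mr_act -whiskr_comp -hcomp_id -!compA.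
rewrite [asc F X A \v (_ \h idm A \v _)]compA asc_nat.
rewrite [asc F X A \v (_ \h alg_mul A \v _)]compA asc_nat -!compA -pentagon.
by rewrite !compA !whiskl_comp rm_actA.
Qed.

Lemma mr_act1 :
  mr_act \v (idm (F \c X) \h alg_unit A) = runit (F \c X).
Proof.
rewrite /mr_act -hcomp_id -compA asc_nat compA whiskl_comp rm_act1.
exact: asc_runit.
Qed.

Definition mr_ob : rmodule A l := RModule mr_actA mr_act1.

End Act.

Lemma mr_rlin (j l : D) (F G : D j l) (X Y : rmodule A j) (a : hom F G)
    (u : rmodhom X Y) :
  a \h rmodhom_val u \in rlin (mr_ob F X) (mr_ob G Y).
Proof.
rewrite inE /= /mr_act -compA asc_nat compA -interchange comp1m rmodhomE.
by rewrite -[in X in X \h _](compm1 a) interchange compA.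
Qed.

Definition mr_map (j l : D) (F G : D j l) (X Y : rmodcat A j) (a : hom F G)
    (u : hom X Y) : (hom (mr_ob F X : rmodcat A l) (mr_ob G Y)) :=
  RModHom (mr_rlin a u).

Lemma mr_ob_comp (j l m : D) (G : D l m) (F : D j l) (X : rmodule A j) :
  mr_ob (G \c F) X = mr_ob G (mr_ob F X).
Proof.
apply: (@rmodule_eq _ _ _ _ _ (mr_ob (G \c F) X) (mr_ob G (mr_ob F X))
  (comp1A G F X)) => /=.
rewrite /mr_act -[eqm (comp1A G F X)]/(asc G F X) /=.
rewrite -whiskl_comp -!compA [(_ \h asc F X A) \v _]compA pentagon !compA.
by rewrite -hcomp_id asc_nat.
Qed.

Lemma mr_ob_one (j : D) (X : rmodule A j) : mr_ob (one j) X = X.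
Proof.
apply: (@rmodule_eq _ _ _ _ _ (mr_ob (one j) X) X (comp1f X)) => /=.
rewrite /mr_act -[eqm (comp1f X)]/(lunit X) compA hcomp1m.
by rewrite -compA asc_lunit.
Qed.

Lemma mr_map_linl (j l : D) (F G : D j l) (X Y : rmodcat A j) (u : hom X Y) :
  linear (fun a : hom F G => mr_map a u).
Proof. by move=> k a b; apply: val_inj; apply: hcomp_linl. Qed.

Lemma mr_map_linr (j l : D) (F G : D j l) (X Y : rmodcat A j) (a : hom F G) :
  linear (fun u : hom X Y => mr_map a u).
Proof. by move=> k u v; apply: val_inj; apply: hcomp_linr. Qed.

Lemma mr_map_id (j l : D) (F : D j l) (X : rmodcat A j) :
  mr_map (idm F) (idm X) = idm (mr_ob F X : rmodcat A l).
Proof. by apply: val_inj; apply: hcomp_id. Qed.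

Lemma mr_map_comp (j l : D) (F G H : D j l) (X Y Z : rmodcat A j)
    (b : hom G H) (a : hom F G) (v : hom Y Z) (u : hom X Y) :
  mr_map (b \v a) (v \v u) = mr_map b v \v mr_map a u.
Proof. by apply: val_inj; apply: interchange. Qed.

Lemma mr_map_hcomp (j l m : D) (G G' : D l m) (F F' : D j l)
    (X Y : rmodcat A j) (b : hom G G') (a : hom F F') (u : hom X Y) :
  eqm (mr_ob_comp G' F' Y : _ = _ :> rmodcat A m) \v mr_map (b \h a) u
  = mr_map b (mr_map a u) \v eqm (mr_ob_comp G F X : _ = _ :> rmodcat A m).
Proof.
apply: val_inj => /=; rewrite !rmodcat_eqm.
rewrite (eqm_irr (congr1 _ (mr_ob_comp G' F' Y)) (comp1A G' F' Y)).
rewrite (eqm_irr (congr1 _ (mr_ob_comp G F X)) (comp1A G F X)).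
exact: hcompA.
Qed.

Lemma mr_map_one (j : D) (X Y : rmodcat A j) (u : hom X Y) :
  eqm (mr_ob_one Y : _ = _ :> rmodcat A j) \v mr_map (idm (one j)) u
  = u \v eqm (mr_ob_one X : _ = _ :> rmodcat A j).
Proof.
apply: val_inj => /=; rewrite !rmodcat_eqm.
rewrite (eqm_irr (congr1 _ (mr_ob_one Y)) (comp1f Y)).
rewrite (eqm_irr (congr1 _ (mr_ob_one X)) (comp1f X)).
exact: hcomp1m.
Qed.

Definition mod_rep : tworep D :=
  @TwoRep K D (fun j => rmodcat A j) mr_ob mr_map mr_map_linl mr_map_linr
    mr_map_id mr_map_comp mr_ob_comp mr_ob_one mr_map_hcomp mr_map_one.

End ModRep.

Section BimodHom.
Variables (K : fieldType) (D : twocat K).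

Record bimodhom (i j : D) (A : algebra i) (B : algebra j)
    (M N : bimodule A B) := BimodHom {
  bh_val :> hom (M : D j i) N;
  bh_l : bm_l N \v (idm A \h bh_val) = bh_val \v bm_l M;
  bh_r : bm_r N \v (bh_val \h idm B) = bh_val \v bm_r M
}.

Lemma bimod_id_l (i j : D) (A : algebra i) (B : algebra j)
    (M : bimodule A B) : bm_l M \v (idm A \h idm M) = idm M \v bm_l M.
Proof. by rewrite hcomp_id compm1 comp1m. Qed.
Lemma bimod_id_r (i j : D) (A : algebra i) (B : algebra j)
    (M : bimodule A B) : bm_r M \v (idm M \h idm B) = idm M \v bm_r M.
Proof. by rewrite hcomp_id compm1 comp1m. Qed.
Definition bimod_id (i j : D) (A : algebra i) (B : algebra j)
    (M : bimodule A B) : bimodhom M M := BimodHom (bimod_id_l M) (bimod_id_r M).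

Definition regular (i : D) (A : algebra i) : bimodule A A :=
  Bimodule (alg_mulA A) (alg_mul1m A) (alg_mulA A) (alg_mulm1 A) (alg_mulA A).

End BimodHom.

Section Tensor.
Variables (K : fieldType) (D : twocat K) (X : right_exact D).

Section TensorObject.
Variables (i j l : D) (A : algebra i) (B : algebra j) (C : algebra l).
Variables (M : bimodule A B) (N : bimodule B C).

Definition balance : hom ((M \c B) \c N) (M \c N) :=
  (bm_r M \h idm N) - (idm M \h bm_l N) \v asc M B N.

Definition tens_car : D l i := coker X balance.
Definition tens_pi : hom (M \c N) tens_car := coker_pi X balance.

Lemma tens_piP : is_coker balance tens_pi.
Proof. exact: cokerP. Qed.

Lemma tens_bal :
  tens_pi \v (bm_r M \h idm N) = tens_pi \v (idm M \h bm_l N) \v asc M B N.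
Proof.
apply/eqP; rewrite -subr_eq0 -compA -compBr.
by apply/eqP; case: tens_piP.
Qed.

Lemma tens_l_subproof :
  (tens_pi \v (bm_l M \h idm N) \v ascV A M N) \v (idm A \h balance) = 0.
Proof.
rewrite /balance hcompBr compBr; apply/eqP; rewrite subr_eq0; apply/eqP.
have lr : bm_l M \v (idm A \h bm_r M)
    = bm_r M \v (bm_l M \h idm B) \v ascV A M B.
  by rewrite bm_lr -compA ascVK compm1.
rewrite -whiskl_comp -!compA ascV_nat [ascV A M N \v _]compA ascV_nat.
rewrite ![(bm_l M \h idm N) \v (_ \v _)]compA whiskr_comp lr -!whiskr_comp.
rewrite -!compA [tens_pi \v _]compA tens_bal -!compA.
rewrite [asc M B N \v _]compA asc_nat -!compA [(idm M \h _) \v _]compA.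
rewrite !hcomp_id whisk_lr.
rewrite [(bm_l M \h idm N) \v _]compA whisk_rl.
congr (_ \v (_ \v _)).
by rewrite /asc /ascV whiskl_eqm whiskr_eqm !eqm_trans; apply: eqm_irr.
Qed.

Definition tens_l : hom (A \c tens_car) tens_car :=
  desc (coker_whiskl X A tens_piP) tens_l_subproof.

Lemma tens_lE :
  tens_l \v (idm A \h tens_pi) = tens_pi \v (bm_l M \h idm N) \v ascV A M N.
Proof. exact: descE. Qed.

Lemma tens_r_subproof :
  (tens_pi \v (idm M \h bm_r N) \v asc M N C) \v (balance \h idm C) = 0.
Proof.
rewrite /balance hcompBl compBr; apply/eqP; rewrite subr_eq0; apply/eqP.
rewrite -whiskr_comp -!compA asc_nat [asc M N C \v _]compA asc_nat.
rewrite hcomp_id ![(idm M \h bm_r N) \v (_ \v _)]compA whisk_lr.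
rewrite -(whisk_rl (bm_r M) (bm_r N)) -!compA [tens_pi \v _]compA tens_bal.
rewrite -!compA -hcomp_id [asc M B N \v _]compA asc_nat -!compA -pentagon.
rewrite !compA -[_ \v _ \v (idm M \h (_ \h _))]compA whiskl_comp.
rewrite -[_ \v _ \v (idm M \h asc _ _ _)]compA whiskl_comp -bm_lr.
by rewrite -[_ \v _ \v (idm M \h (_ \h idm C))]compA whiskl_comp.
Qed.

Definition tens_r : hom (tens_car \c C) tens_car :=
  desc (coker_whiskr X C tens_piP) tens_r_subproof.

Lemma tens_rE :
  tens_r \v (tens_pi \h idm C) = tens_pi \v (idm M \h bm_r N) \v asc M N C.
Proof. exact: descE. Qed.

Let F := mr_ob M (bm_rmodule N).

Lemma tens_rE' : tens_r \v (tens_pi \h idm C) = tens_pi \v rm_act F.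
Proof. by rewrite tens_rE -compA. Qed.

Lemma tens_lA : tens_l \v (alg_mul A \h idm tens_car)
  = tens_l \v (idm A \h tens_l) \v asc A A tens_car.
Proof.
apply: (coker_epi (coker_whiskl X (A \c A) tens_piP)).
rewrite -compA whisk_rl -whisk_lr compA tens_lE.
rewrite -[RHS]compA -[idm (A \c A)]hcomp_id asc_nat compA -[_ \v _ \v (idm A \h (_ \h _))]compA.
rewrite whiskl_comp tens_lE -!whiskl_comp !compA tens_lE.
rewrite -hcomp_id -!compA ascV_nat [ascV A M N \v ((idm A \h (_ \h _)) \v _)]compA.
rewrite ascV_nat -!compA ![(bm_l M \h idm N) \v (_ \v _)]compA !whiskr_comp bm_lA.
rewrite -!whiskr_comp -!compA; congr (_ \v (_ \v (_ \v _))).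
by rewrite /asc /ascV whiskl_eqm whiskr_eqm !eqm_trans; apply: eqm_irr.
Qed.

Lemma tens_l1 : tens_l \v (alg_unit A \h idm tens_car) = lunit tens_car.
Proof.
apply: (coker_epi (coker_whiskl X (one i) tens_piP)).
rewrite -compA whisk_rl -whisk_lr compA tens_lE.
rewrite /lunit hcomp1m -hcomp_id -!compA ascV_nat.
rewrite [(bm_l M \h idm N) \v _]compA whiskr_comp bm_l1; congr (_ \v _).
by rewrite /lunit /ascV whiskr_eqm !eqm_trans; apply: eqm_irr.
Qed.

Lemma tens_rA : tens_r \v (tens_r \h idm C)
  = tens_r \v (idm tens_car \h alg_mul C) \v asc tens_car C C.
Proof.
apply: (coker_epi (coker_whiskr X C (coker_whiskr X C tens_piP))).
rewrite -compA whiskr_comp tens_rE' -whiskr_comp compA tens_rE' -[LHS]compA.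
rewrite (rm_actA F) -[RHS]compA asc_nat hcomp_id [RHS]compA -[tens_r \v _ \v _]compA.
rewrite whisk_lr -(whisk_rl tens_pi) [tens_r \v _]compA tens_rE'.
by rewrite -2![RHS]compA -(compA (rm_act F)).
Qed.

Lemma tens_r1 : tens_r \v (idm tens_car \h alg_unit C) = runit tens_car.
Proof.
apply: (coker_epi (coker_whiskr X (one l) tens_piP)).
rewrite -compA whisk_lr -whisk_rl compA tens_rE' -compA (rm_act1 F).
by rewrite /runit hcompm1.
Qed.

Lemma tens_lr : tens_r \v (tens_l \h idm C)
  = tens_l \v (idm A \h tens_r) \v asc A tens_car C.
Proof.
apply: (coker_epi (coker_whiskr X C (coker_whiskl X A tens_piP))).
rewrite -compA whiskr_comp tens_lE -!whiskr_comp !compA tens_rE.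
rewrite -[RHS]compA asc_nat compA -[_ \v _ \v (idm A \h (_ \h _))]compA.
rewrite whiskl_comp tens_rE -!whiskl_comp !compA tens_lE.
rewrite -!compA [asc M N C \v _]compA asc_nat hcomp_id -!compA.
rewrite [(idm M \h _) \v _]compA whisk_lr.
rewrite [ascV A M N \v _]compA ascV_nat hcomp_id -!compA.
rewrite [(bm_l M \h idm N) \v _]compA whisk_rl; congr (_ \v (_ \v _)).
by rewrite /asc /ascV whiskl_eqm whiskr_eqm !eqm_trans; apply: eqm_irr.
Qed.

Definition tensor : bimodule A C :=
  Bimodule tens_lA tens_l1 tens_rA tens_r1 tens_lr.

End TensorObject.

Section TensorHom.
Variables (i j l : D) (A : algebra i) (B : algebra j) (C : algebra l).
Variables (M M' : bimodule A B) (N N' : bimodule B C).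
Variables (u : bimodhom M M') (v : bimodhom N N').

Lemma tens_hom_subproof :
  (tens_pi M' N' \v (bh_val u \h bh_val v)) \v balance M N = 0.
Proof.
rewrite /balance compBr; apply/eqP; rewrite subr_eq0; apply/eqP.
rewrite -compA -interchange compm1 -bh_r -[X in _ \h X]comp1m interchange.
rewrite compA tens_bal -!compA asc_nat; congr (_ \v _).
by rewrite !compA -!interchange comp1m compm1 bh_l.
Qed.

Definition tens_hom : hom (tens_car M N) (tens_car M' N') :=
  desc (tens_piP M N) tens_hom_subproof.

End TensorHom.

Section TensorAssoc.
Variables (i j l m : D) (A : algebra i) (B : algebra j) (C : algebra l).
Variables (E : algebra m).
Variables (M : bimodule A B) (N : bimodule B C) (P : bimodule C E).

Definition tens_assoc0 :
    hom ((M \c N) \c P) (tens_car M (tensor N P)) :=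
  tens_pi M (tensor N P) \v (idm M \h tens_pi N P) \v asc M N P.

Lemma tens_assoc1_subproof : tens_assoc0 \v (balance M N \h idm P) = 0.
Proof.
rewrite /balance hcompBl compBr; apply/eqP; rewrite subr_eq0; apply/eqP.
rewrite /tens_assoc0 -whiskr_comp -!compA asc_nat hcomp_id.
rewrite [(idm M \h _) \v (bm_r M \h _ \v _)]compA whisk_lr -whisk_rl.
rewrite -!compA [tens_pi _ _ \v _]compA tens_bal -!compA.
rewrite [asc M B _ \v _]compA -hcomp_id asc_nat -!compA.
rewrite [(idm M \h bm_l _) \v _]compA whiskl_comp tens_lE -!whiskl_comp.
rewrite [asc M N P \v _]compA asc_nat -!compA.
congr (_ \v (_ \v (_ \v _))).
by rewrite /asc /ascV whiskl_eqm whiskr_eqm !eqm_trans; apply: eqm_irr.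
Qed.

Definition tens_assoc1 : hom (tens_car M N \c P) (tens_car M (tensor N P)) :=
  desc (coker_whiskr X P (tens_piP M N)) tens_assoc1_subproof.

Lemma tens_assoc1E : tens_assoc1 \v (tens_pi M N \h idm P) = tens_assoc0.
Proof. exact: descE. Qed.

Lemma tens_assoc_subproof : tens_assoc1 \v balance (tensor M N) P = 0.
Proof.
rewrite /balance compBr; apply/eqP; rewrite subr_eq0; apply/eqP.
apply: (coker_epi (coker_whiskr X P (coker_whiskr X C (tens_piP M N)))).
rewrite -compA whiskr_comp tens_rE -!whiskr_comp !compA tens_assoc1E.
rewrite -[RHS]compA asc_nat hcomp_id compA -[_ \v _ \v (tens_pi _ _ \h _)]compA.
rewrite whisk_lr -(whisk_rl (tens_pi M N)) compA tens_assoc1E /tens_assoc0.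
rewrite -!compA [asc M N P \v _]compA asc_nat -!compA.
rewrite [asc M N P \v _]compA -hcomp_id asc_nat -!compA -pentagon.
rewrite ![(idm M \h tens_pi N P) \v (_ \v _)]compA !whiskl_comp tens_bal.
by rewrite -!whiskl_comp -!compA.
Qed.

(* The invertible 2-morphism suppressed when one writes an iterated tensor
   product without parentheses: it is induced by asc M N P.                 *)
Definition tens_assoc :
    hom (tens_car (tensor M N) P) (tens_car M (tensor N P)) :=
  desc (tens_piP (tensor M N) P) tens_assoc_subproof.

End TensorAssoc.

Section TensorUnit.
Variables (i j : D) (A : algebra i) (B : algebra j) (M : bimodule A B).

Lemma tens_lunit_subproof : bm_l M \v balance (regular A) M = 0.
Proof. by rewrite /balance compBr bm_lA compA subrr. Qed.

Definition tens_lunit : hom (tens_car (regular A) M) M :=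
  desc (tens_piP (regular A) M) tens_lunit_subproof.

Lemma tens_runit_subproof : bm_r M \v balance M (regular B) = 0.
Proof. by rewrite /balance compBr bm_rA compA subrr. Qed.

Definition tens_runit : hom (tens_car M (regular B)) M :=
  desc (tens_piP M (regular B)) tens_runit_subproof.

End TensorUnit.

End Tensor.

(* Main.v *)
(* A morphism Phi of 2-representations turns a map h : F Y -> Z of A-modules,
   F a 1-morphism, into sharp h : F Phi(Y) -> Phi(Z), compatibly with
   composition, and bijectively when Phi is an equivalence. The equations
   defining a Morita context can therefore be transported along Phi. One takes
   M = Phi(A) with left action sharp(mul_A), and N with e : Phi(N) = B; the left
   action of N and the pairing M N -> A are the maps whose sharp are, up to e,
   the multiplication of B and the right action of M, and the pairing N M -> B
   is e o sharp(act_N). The pairings descend to isomorphisms of the tensor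
   products because the action X A -> X of a module is the cokernel of
   X A A -> X A. Conversely - o_A M is a morphism of 2-representations because
   composition is right exact, and the isomorphisms f and g make - o_B N its
   inverse.                                                                  *)
From mathcomp Require Import all_boot all_order all_algebra.
From mathcomp Require Import boolp.
Require Import Defs.

Set Implicit Arguments.
Unset Strict Implicit.
Unset Printing Implicit Defensive.

Import GRing.Theory.
Local Open Scope ring_scope.
Local Open Scope cat_scope.

(** * Isomorphisms, epimorphisms and cokernels in a linear category *)

Section Isomorphisms.
Variables (K : fieldType) (A : lincat K).
Implicit Types X Y Z : A.

Definition inv_iso X Y (f : hom X Y) (iso_f : is_iso f) : hom Y X :=
  sval (cid iso_f).

Lemma inv_isoK X Y (f : hom X Y) (iso_f : is_iso f) :
  inv_iso iso_f \v f = idm X.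
Proof. by rewrite /inv_iso; case: cid => g []. Qed.

Lemma inv_isoVK X Y (f : hom X Y) (iso_f : is_iso f) :
  f \v inv_iso iso_f = idm Y.
Proof. by rewrite /inv_iso; case: cid => g []. Qed.

Lemma iso_inv X Y (f : hom X Y) (iso_f : is_iso f) : is_iso (inv_iso iso_f).
Proof. by exists f; rewrite inv_isoK inv_isoVK. Qed.

Lemma iso_epi X Y (f : hom X Y) : is_iso f -> epi f.
Proof.
move=> [f' [_ ff']] Z g h e.
by rewrite -(compm1 g) -(compm1 h) -ff' !compA e.
Qed.

Lemma epi_comp X Y Z (g : hom Y Z) (f : hom X Y) :
  epi g -> epi f -> epi (g \v f).
Proof. by move=> eg ef W u v; rewrite !compA => /ef /eg. Qed.

Lemma section_epi X Y (f : hom X Y) (s : hom Y X) : f \v s = idm Y -> epi f.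
Proof. by move=> fs Z g h e; rewrite -(compm1 g) -(compm1 h) -fs !compA e. Qed.

(** The difference of two maps that agree on [f] factors through the zero cokernel. Together with
    [epi_coker0] this turns being an epimorphism into the vanishing of a cokernel, a condition that
    right exact functors preserve. *)
Lemma coker0_epi X Y (f : hom X Y) (Q : A) (p : hom Y Q) :
  is_coker f p -> p = 0 -> epi f.
Proof.
move=> [_ univ] p0 Z g h gfhf; apply/eqP; rewrite -subr_eq0; apply/eqP.
have [|v [<- _]] := univ _ (g - h); first by rewrite compBl gfhf subrr.
by rewrite p0 compm0.
Qed.

Lemma epi_coker0 X Y (f : hom X Y) (Q : A) (p : hom Y Q) :
  epi f -> is_coker f p -> p = 0.
Proof. by move=> ef [pf _]; apply: ef; rewrite pf comp0m. Qed.

Lemma iso_projective X Y (f : hom X Y) :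
  is_iso f -> projective Y -> projective X.
Proof.
move=> [f' [f'f _]] projY Z W e h epi_e.
have [g eg] := projY _ _ _ (h \v f') epi_e.
by exists (g \v f); rewrite compA eg -compA f'f compm1.
Qed.

End Isomorphisms.

(** * Equivalences preserve and reflect epimorphisms and projectives *)

Section Equivalences.
Variables (K : fieldType) (A B : lincat K) (F : linfunctor A B).
Hypothesis equivF : equivalence F.

Lemma equiv_faithful (X Y : A) (u v : hom X Y) : fmap F u = fmap F v -> u = v.
Proof.
case: equivF => G [[eta [eta_iso eta_nat]] _] e.
have [s [st _]] := eta_iso Y.
by rewrite -(comp1m u) -(comp1m v) -st -!compA !eta_nat e.
Qed.

Lemma equiv_full (X Y : A) (k : hom (F X) (F Y)) : exists u, fmap F u = k.
Proof.
case: equivF => G [[eta [eta_iso eta_nat]] [eps [eps_iso eps_nat]]].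
(* The preimage is [G k] transported along [eta]. Naturality of [eta] gives G F u = G k, and
   naturality of the isomorphism [eps] then gives F u = k. *)
have [s [s_eta eta_s]] := eta_iso Y; exists (s \v fmap G k \v eta X).
have [s' [s'_eps _]] := eps_iso (F Y).
set u := s \v _ \v _.
have Gu : fmap G (fmap F u) = fmap G k.
  apply: (iso_epi (eta_iso X)).
  by rewrite -eta_nat /u !compA eta_s comp1m.
apply: (iso_epi (eps_iso (F X))).
by rewrite -!eps_nat Gu.
Qed.

Lemma equiv_esurj (Y : B) : exists (X : A) (r : hom (F X) Y), is_iso r.
Proof. by case: equivF => G [_ [eps [eps_iso _]]]; exists (G Y), (eps Y). Qed.

Lemma equiv_projective (P : A) : projective P -> projective (F P).
Proof.
move=> projP X Y e f epi_e.
have [X' [r [r' [r'r rr']]]] := equiv_esurj X.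
have [Y' [s [s' [s's ss']]]] := equiv_esurj Y.
have [e' Fe'] := equiv_full (s' \v e \v r).
have [f' Ff'] := equiv_full (s' \v f).
(* The image of [e'] under [F] is [e] between two isomorphisms, and faithfulness reflects its
   cancellation property. *)
have epi_e' : epi e'.
  move=> Z g h geqh; apply: equiv_faithful.
  have := congr1 (fun u => fmap F u) geqh; rewrite !fmap_comp Fe' !compA.
  move=> /iso_epi; move/(_ (ex_intro _ r' (conj r'r rr'))) /epi_e.
  by move/iso_epi; apply; exists s.
have [g eg] := projP _ _ _ f' epi_e'.
exists (r \v fmap F g); rewrite compA.
have -> : e \v r = s \v fmap F e' by rewrite Fe' !compA ss' comp1m.
by rewrite -compA -fmap_comp eg Ff' compA ss' comp1m.
Qed.

Lemma equiv_epi (X Y : A) (f : hom X Y) : epi f -> epi (fmap F f).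
Proof.
move=> epi_f W u v e.
have [W' [r [r' [r'r rr']]]] := equiv_esurj W.
have [u' uE] := equiv_full (r' \v u).
have [v' vE] := equiv_full (r' \v v).
have uv : u' = v'.
  apply: epi_f; apply: equiv_faithful.
  by rewrite !fmap_comp uE vE -!compA e.
by rewrite -(comp1m u) -(comp1m v) -rr' -!compA -uE -vE uv.
Qed.

Lemma equiv_projective_reflect (P : A) : projective (F P) -> projective P.
Proof.
move=> projFP X Y e f epi_e.
have [k kE] := projFP _ _ _ (fmap F f) (equiv_epi epi_e).
have [g gE] := equiv_full k; exists g; apply: equiv_faithful.
by rewrite fmap_comp gE.
Qed.

End Equivalences.

(** * Transport of maps F X -> Z along a morphism of 2-representations *)

Section Sharp.
Variables (K : fieldType) (D : twocat K) (P Q : tworep D).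
Variable Phi : tworep_mor P Q.

Definition sharp (i j : D) (F : D i j) (X : P i) (Z : P j)
    (h : hom (rep1 P F X) Z) : hom (rep1 Q F (Phi i X)) (Phi j Z) :=
  fmap (Phi j) h \v inv_iso (trm_isoP Phi F X).

Lemma sharp_iso (i j : D) (F : D i j) (X : P i) (Z : P j)
    (h : hom (rep1 P F X) Z) :
  sharp h \v trm_iso Phi F X = fmap (Phi j) h.
Proof. by rewrite /sharp -compA inv_isoK compm1. Qed.

Lemma trm_epi (i j : D) (F : D i j) (X : P i) : epi (trm_iso Phi F X).
Proof. exact: iso_epi (trm_isoP Phi F X). Qed.

Lemma sharp_pre (i j : D) (F G : D i j) (X Y : P i) (Z : P j)
    (h : hom (rep1 P F X) Z) (a : hom G F) (u : hom Y X) :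
  sharp h \v rep2 Q a (fmap (Phi i) u) = sharp (h \v rep2 P a u).
Proof.
apply: trm_epi; rewrite sharp_iso -compA -trm_nat compA sharp_iso.
by rewrite fmap_comp.
Qed.

Lemma sharp_post (i j : D) (F : D i j) (X : P i) (Z W : P j)
    (h : hom (rep1 P F X) Z) (v : hom Z W) :
  fmap (Phi j) v \v sharp h = sharp (v \v h).
Proof. by rewrite /sharp compA fmap_comp. Qed.

(** Associativity laws live over composite 1-morphisms and cross [Phi] through this rule. It
    combines the coherence law [trm_comp] with naturality of the structure isomorphisms. *)
Lemma sharp_comp (i j l : D) (G : D j l) (F : D i j) (X : P i) (Y : P j)
    (Z : P l) (h : hom (rep1 P G Y) Z) (k : hom (rep1 P F X) Y) :
  sharp h \v rep2 Q (idm G) (sharp k) \v eqm (rep1_comp G F (Phi i X))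
  = sharp (h \v rep2 P (idm G) k \v eqm (rep1_comp G F X)).
Proof.
apply: trm_epi; rewrite sharp_iso !fmap_comp.
rewrite -compA trm_comp !compA -[_ \v _ \v rep2 _ _ (trm_iso _ _ _)]compA.
rewrite -rep2_comp comp1m sharp_iso -[_ \v trm_iso _ _ _]compA -trm_nat.
by rewrite compA sharp_iso.
Qed.

Lemma sharp_one (i : D) (X : P i) :
  sharp (eqm (rep1_one X)) = eqm (rep1_one (Phi i X)).
Proof. by apply: trm_epi; rewrite sharp_iso trm_one. Qed.

Hypothesis equivPhi : forall i, equivalence (Phi i).

Lemma sharp_inj (i j : D) (F : D i j) (X : P i) (Z : P j) :
  injective (@sharp i j F X Z).
Proof.
move=> h k e; apply: (equiv_faithful (equivPhi j)).
by rewrite -!sharp_iso e.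
Qed.

Lemma sharp_surj (i j : D) (F : D i j) (X : P i) (Z : P j)
    (w : hom (rep1 Q F (Phi i X)) (Phi j Z)) : exists h, sharp h = w.
Proof.
have [h hw] := equiv_full (equivPhi j) (w \v trm_iso Phi F X).
by exists h; apply: trm_epi; rewrite sharp_iso.
Qed.

End Sharp.

(** * Naturality of the unitors *)

Section Units.
Variables (K : fieldType) (D : twocat K).

Lemma runitK i j (F : D i j) : runitV F \v runit F = idm _.
Proof. exact: eqmVm. Qed.

Lemma runitVK i j (F : D i j) : runit F \v runitV F = idm _.
Proof. exact: eqmmV. Qed.

Lemma lunitK i j (F : D i j) : lunitV F \v lunit F = idm _.
Proof. exact: eqmVm. Qed.

Lemma lunitVK i j (F : D i j) : lunit F \v lunitV F = idm _.
Proof. exact: eqmmV. Qed.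

Lemma runit_nat i j (F G : D i j) (a : hom F G) :
  runit G \v (a \h idm (one i)) = a \v runit F.
Proof. exact: hcompm1. Qed.

Lemma lunit_nat i j (F G : D i j) (a : hom F G) :
  lunit G \v (idm (one j) \h a) = a \v lunit F.
Proof. exact: hcomp1m. Qed.

Lemma runitV_nat i j (F G : D i j) (a : hom F G) :
  runitV G \v a = (a \h idm (one i)) \v runitV F.
Proof.
rewrite -[a in LHS]compm1 -(runitVK F) [a \v _]compA -runit_nat !compA.
by rewrite runitK comp1m.
Qed.

Lemma lunitV_nat i j (F G : D i j) (a : hom F G) :
  lunitV G \v a = (idm (one j) \h a) \v lunitV F.
Proof.
rewrite -[a in LHS]compm1 -(lunitVK F) [a \v _]compA -lunit_nat !compA.
by rewrite lunitK comp1m.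
Qed.

End Units.

(** * Right modules over an algebra 1-morphism *)

Section RightModules.
Variables (K : fieldType) (D : twocat K).

Section OverAlgebra.
Variables (i : D) (A : algebra i).

Lemma rmodcat_compE (j : D) (X Y Z : rmodcat A j) (v : hom Y Z) (u : hom X Y) :
  rmodhom_val (v \v u) = rmodhom_val v \v rmodhom_val u.
Proof. by []. Qed.

Lemma rmodhom_ext (j : D) (X Y : rmodule A j) (u v : rmodhom X Y) :
  rmodhom_val u = rmodhom_val v -> u = v.
Proof. exact: val_inj. Qed.

Lemma rmodule_eta (j : D) (Y : rmodule A j) :
  RModule (rm_actA Y) (rm_act1 Y) = Y.
Proof. by case: Y. Qed.

Lemma rmodcat_eqm_comp (j l m : D) (G : D l m) (F : D j l) (X : rmodule A j) :
  rmodhom_val (eqm (mr_ob_comp G F X : _ = _ :> rmodcat A m)) = asc G F X.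
Proof. by rewrite rmodcat_eqm; apply: eqm_irr. Qed.

Lemma rmodcat_eqm_one (j : D) (X : rmodule A j) :
  rmodhom_val (eqm (mr_ob_one X : _ = _ :> rmodcat A j)) = lunit X.
Proof. by rewrite rmodcat_eqm; apply: eqm_irr. Qed.

Lemma rlin_inv (j : D) (X Y : rmodule A j) (u : rmodhom X Y)
    (iso_u : is_iso (rmodhom_val u)) : inv_iso iso_u \in rlin Y X.
Proof.
rewrite inE; apply/eqP.
rewrite -[LHS]comp1m -(inv_isoK iso_u) -!compA; congr (_ \v _).
by rewrite compA -rmodhomE -compA whiskr_comp inv_isoVK hcomp_id compm1.
Qed.

Lemma iso_rmodcat (j : D) (X Y : rmodcat A j) (u : hom X Y) :
  is_iso (rmodhom_val u) -> is_iso u.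
Proof.
move=> iso_u; exists (RModHom (rlin_inv iso_u)); split; apply: val_inj => /=.
  exact: inv_isoK.
exact: inv_isoVK.
Qed.

Lemma epi_rmodcat (j : D) (X Y : rmodcat A j) (u : hom X Y) :
  epi (rmodhom_val u) -> epi u.
Proof.
move=> eu Z g h e; apply: val_inj; apply: eu.
exact: (congr1 (fun w : rmodhom X Z => rmodhom_val w) e).
Qed.

(** Since [p] is linear, linearity of a map out of its target can be tested on its source. This
    serves for maps obtained by descent to a quotient. *)
Lemma rlin_factor (j : D) (X Y Z : rmodule A j) (p : rmodhom X Y)
    (v : hom (Y : D i j) Z) :
  epi (rmodhom_val p \h idm A) -> v \v rmodhom_val p \in rlin X Z ->
  v \in rlin Y Z.
Proof.
move=> ep /eqP vp; rewrite inE; apply/eqP; apply: ep.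
by rewrite -compA whiskr_comp vp -!compA rmodhomE.
Qed.

Definition reg : rmodule A i := bm_rmodule (regular A).

Section Action.
Variables (j : D) (X : rmodule A j).

Lemma act_rlin : rm_act X \in rlin (mr_ob X reg) X.
Proof. by rewrite inE rm_actA /= /mr_act compA. Qed.
Definition act_hom : hom (mr_ob X reg : rmodcat A j) X := RModHom act_rlin.

Lemma act_section : rm_act X \v ((idm X \h alg_unit A) \v runitV X) = idm X.
Proof. by rewrite compA rm_act1 runitVK. Qed.

Lemma act_epi : epi (rm_act X).
Proof. exact: section_epi act_section. Qed.

Lemma act_epi_whiskr (l : D) (F : D l i) : epi (rm_act X \h idm F).
Proof.
apply: (@section_epi _ _ _ _ _ (((idm X \h alg_unit A) \v runitV X) \h idm F)).
by rewrite whiskr_comp act_section hcomp_id.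
Qed.

(* The action X A -> X is the cokernel of X A A -> X A, split by the unit. *)
Lemma act_univ (R : rmodule A j) (w : hom (mr_ob X reg : rmodcat A j) R) :
  rmodhom_val w \v (rm_act X \h idm A)
    = rmodhom_val w \v (idm X \h alg_mul A) \v asc X A A ->
  exists v : hom (X : rmodcat A j) R, v \v act_hom = w.
Proof.
move=> w_bal.
pose v := rmodhom_val w \v ((idm X \h alg_unit A) \v runitV X).
have v_act : v \v rm_act X = rmodhom_val w.
  rewrite /v -!compA.
  rewrite runitV_nat [(idm X \h _) \v _]compA whisk_lr -whisk_rl.
  rewrite -[_ \v runitV _]compA.
  rewrite !compA w_bal -hcomp_id -!compA [asc X A A \v _]compA asc_nat.
  rewrite !compA -[_ \v _ \v (idm X \h _)]compA whiskl_comp alg_mulm1.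
  rewrite -[_ \v asc _ _ _]compA asc_runit -compA runitVK.
  exact: compm1.
have v_lin : v \in rlin X R.
  apply: (@rlin_factor _ _ _ _ act_hom); first exact: act_epi_whiskr.
  by rewrite /= v_act; apply: rmodhomP.
by exists (RModHom v_lin); apply: val_inj.
Qed.

End Action.

(** The regular module is free on the identity 1-morphism. The composite of [f] with the unit is
    lifted to [s] first, and [w] is the linear extension of [s], in elements a |-> s a. *)
Lemma reg_projective : projective (one i : D i i) ->
  (forall (X Y : rmodcat A i) (e : hom X Y), epi e -> epi (rmodhom_val e)) ->
  projective (reg : rmodcat A i).
Proof.
move=> proj_one epi_val X Y e f epi_e.
have [s es] :=
  proj_one _ _ _ (rmodhom_val f \v alg_unit A) (epi_val _ _ _ epi_e).
pose w := rmodhom_val (act_hom X) \v (s \h idm A) \v lunitV A.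
have w_lin : w \in rlin (reg : rmodule A i) X.
  rewrite inE; apply/eqP.
  rewrite /w -!whiskr_comp !compA rm_actA -!compA.
  rewrite [asc X A A \v _]compA asc_nat hcomp_id -!compA; congr (_ \v _).
  rewrite [(idm X \h _) \v _]compA whisk_lr -whisk_rl -compA; congr (_ \v _).
  rewrite lunitV_nat /lunitV /ascV /asc whiskr_eqm eqm_trans; congr (_ \v _).
  exact: eqm_irr.
exists (RModHom w_lin); apply: val_inj; rewrite /= /w !compA -rmodhomE.
rewrite -[_ \v _ \v (s \h _)]compA whiskr_comp es -whiskr_comp !compA rmodhomE.
rewrite -[_ \v _ \v (alg_unit _ \h _)]compA alg_mul1m -compA.
by rewrite lunitVK compm1.
Qed.

End OverAlgebra.
End RightModules.

(** * Epimorphisms and cokernels of modules under right exact composition *)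

Section RightExact.
Variables (K : fieldType) (D : twocat K) (X : right_exact D).

(** A map is epi exactly when its cokernel projection vanishes, and whiskering preserves
    cokernels. *)
Lemma epi_whiskl (i j l : D) (H : D j l) (F G : D i j) (f : hom F G) :
  epi f -> epi (idm H \h f).
Proof.
move=> ef; have cokf := cokerP X f.
apply: coker0_epi (coker_whiskl X H cokf) _.
by rewrite (epi_coker0 ef cokf) hcompm0.
Qed.

Lemma epi_whiskr (i j l : D) (F G : D j l) (f : hom F G) (H : D i j) :
  epi f -> epi (f \h idm H).
Proof.
move=> ef; have cokf := cokerP X f.
apply: coker0_epi (coker_whiskr X H cokf) _.
by rewrite (epi_coker0 ef cokf) hcomp0m.
Qed.

Section RModCoker.
Variables (i j : D) (A : algebra i) (Y Z : rmodule A j) (e : rmodhom Y Z).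

Let q := coker_pi X (rmodhom_val e).
Let cok : is_coker (rmodhom_val e) q := cokerP X _.

Lemma rmod_coker_subproof : (q \v rm_act Z) \v (rmodhom_val e \h idm A) = 0.
Proof. by rewrite -compA rmodhomE compA cok.1 comp0m. Qed.

Definition rmod_coker_act := desc (coker_whiskr X A cok) rmod_coker_subproof.

Lemma rmod_coker_actE : rmod_coker_act \v (q \h idm A) = q \v rm_act Z.
Proof. exact: descE. Qed.

Lemma rmod_coker_actA : rmod_coker_act \v (rmod_coker_act \h idm A)
  = rmod_coker_act \v (idm _ \h alg_mul A) \v asc _ A A.
Proof.
apply: (coker_epi (coker_whiskr X A (coker_whiskr X A cok))).
rewrite -compA whiskr_comp rmod_coker_actE -whiskr_comp compA rmod_coker_actE.
rewrite -compA rm_actA -[RHS]compA asc_nat hcomp_id [RHS]compA.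
rewrite -[rmod_coker_act \v _ \v _]compA whisk_lr -(whisk_rl q).
by rewrite [rmod_coker_act \v (_ \v _)]compA rmod_coker_actE !compA.
Qed.

Lemma rmod_coker_act1 :
  rmod_coker_act \v (idm _ \h alg_unit A) = runit _.
Proof.
apply: (coker_epi (coker_whiskr X (one i) cok)).
rewrite -compA whisk_lr -whisk_rl compA rmod_coker_actE -compA rm_act1.
by rewrite runit_nat.
Qed.

Definition rmod_coker : rmodule A j := RModule rmod_coker_actA rmod_coker_act1.

Lemma rmod_coker_rlin : q \in rlin Z rmod_coker.
Proof. by rewrite inE rmod_coker_actE. Qed.

(** By right exactness the cokernel of the underlying 2-morphism is again a module and its
    projection a module map. An epimorphism of modules forces this projection to be zero. *)
Lemma rmodcat_epi : epi (e : hom (Y : rmodcat A j) Z) -> epi (rmodhom_val e).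
Proof.
move=> epi_e; apply: coker0_epi cok _.
pose Q : rmodcat A j := rmod_coker.
have := epi_e Q (RModHom rmod_coker_rlin) 0.
rewrite comp0m => h.
apply: (congr1 (fun w : rmodhom Z rmod_coker => rmodhom_val w) (h _)).
by apply: val_inj => /=; rewrite cok.1.
Qed.

End RModCoker.

Section LModCoker.
Variables (i j : D) (A : algebra i) (Y Z : lmodule A j) (e : lmodhom Y Z).

Let q := coker_pi X (lmodhom_val e).
Let cok : is_coker (lmodhom_val e) q := cokerP X _.

Lemma lmod_coker_subproof : (q \v lm_act Z) \v (idm A \h lmodhom_val e) = 0.
Proof. by rewrite -compA lmodhomE compA cok.1 comp0m. Qed.

Definition lmod_coker_act := desc (coker_whiskl X A cok) lmod_coker_subproof.

Lemma lmod_coker_actE : lmod_coker_act \v (idm A \h q) = q \v lm_act Z.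
Proof. exact: descE. Qed.

Lemma lmod_coker_actA : lmod_coker_act \v (alg_mul A \h idm _)
  = lmod_coker_act \v (idm A \h lmod_coker_act) \v asc A A _.
Proof.
apply: (coker_epi (coker_whiskl X (A \c A) cok)).
rewrite -compA whisk_rl -whisk_lr compA lmod_coker_actE -compA lm_actA.
rewrite -[RHS]compA -[idm (A \c A)]hcomp_id asc_nat [RHS]compA.
rewrite -[lmod_coker_act \v _ \v _]compA whiskl_comp lmod_coker_actE.
rewrite -whiskl_comp [lmod_coker_act \v (_ \v _)]compA.
by rewrite lmod_coker_actE !compA.
Qed.

Lemma lmod_coker_act1 :
  lmod_coker_act \v (alg_unit A \h idm _) = lunit _.
Proof.
apply: (coker_epi (coker_whiskl X (one i) cok)).
rewrite -compA whisk_rl -whisk_lr compA lmod_coker_actE -compA lm_act1.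
by rewrite lunit_nat.
Qed.

Definition lmod_coker : lmodule A j := LModule lmod_coker_actA lmod_coker_act1.

Lemma lmod_coker_llin : q \in llin Z lmod_coker.
Proof. by rewrite inE lmod_coker_actE. Qed.

Lemma lmodcat_epi : epi (e : hom (Y : lmodcat A j) Z) -> epi (lmodhom_val e).
Proof.
move=> epi_e; apply: coker0_epi cok _.
pose Q : lmodcat A j := lmod_coker.
have := epi_e Q (LModHom lmod_coker_llin) 0.
rewrite comp0m => h.
apply: (congr1 (fun w : lmodhom Z lmod_coker => lmodhom_val w) (h _)).
by apply: val_inj => /=; rewrite cok.1.
Qed.

End LModCoker.

End RightExact.

(** * Projective objects of the abelianization *)

Section AbelProjective.
Variables (K : fieldType) (C : twocat K).

(** An object without relations has the morphisms of its top as its raw morphisms, so a lift only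
    has to be found on tops, modulo the relations of the target. *)
Lemma abel_projective (i j : abel C) (P : abel C i j) :
  alen P = 0%N -> projective P.
Proof.
move=> P0 Y Z e f epi_e.
have noP (x : 'I_(alen P)) : False by move: x; rewrite P0 => -[].
(* The cokernel projection is the identity on tops. Its vanishing writes the identity of [atop Z]
   through the relations of the cokernel, namely those of [Z] and the extra one [E]. *)
have [q0 /= sumq] := (acls_eq0 _).1 (epi_coker0 epi_e (abel_cokerP e)).
pose q t : hom (atop Z) (kgen Y (split t)) := q0 t.
pose E := rtop (arep e).
(* Each summand is sorted into a part through [E] and a part through the relations of [Z];
   collecting the parts gives [a] and [b]. *)
have dec t : exists ab : hom (atop Z) (atop Y) *
    (forall x, hom (atop Z) (agen Z x)),
    krel e (split t) \v q t = E \v ab.1 + \sum_x arel Z x \v ab.2 x.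
  move: (q t); case: (split t) => [x|u] /= c.
    exists (0, fun y => adelta x y \v c); rewrite /= compm0 add0r.
    rewrite -[in LHS]sum_adelta comp_suml; apply: eq_bigr => y _.
    by rewrite compA.
  exists (c, fun=> 0) => /=.
  by rewrite big1 ?addr0 // => y _; rewrite compm0.
pose a := \sum_t (sval (cid (dec t))).1.
pose b x := \sum_t (sval (cid (dec t))).2 x.
have idE : idm (atop Z) = E \v a + \sum_x arel Z x \v b x.
  rewrite -[LHS]sumq /a /b comp_sumr.
  under [X in _ = _ + X]eq_bigr => x _ do rewrite comp_sumr.
  rewrite exchange_big -big_split /=; apply: eq_bigr => t _.
  exact: (svalP (cid (dec t))).
elim/acls_ind: f => f.
have [w wE] : exists w : abraw P Y, rtop w = a \v rtop f.
  by apply: abraw_exists => x; case: (noP x).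
exists (acls w); rewrite -[e]arepK [LHS]ab_compE; apply/aclsP => /=.
(* The lift is a f, and the error E a f - f equals minus the sum of the r_x b_x f over the relations
   r_x of [Z], hence is null. *)
exists (fun x => - (b x \v rtop f)).
rewrite wE -[X in _ = _ - X]comp1m idE compDl -compA opprD addNKr comp_suml.
rewrite -sumrN; apply: eq_bigr => x _.
by rewrite compNr compA.
Qed.

End AbelProjective.

(** * Functoriality of the tensor product over an algebra *)

Section TensorFunctoriality.
Variables (K : fieldType) (D : twocat K) (X : right_exact D).

Lemma tens_epi (i j l : D) (A : algebra i) (B : algebra j) (C : algebra l)
    (M : bimodule A B) (N : bimodule B C) : epi (tens_pi X M N).
Proof. exact: coker_epi (tens_piP X M N). Qed.

Section TensorMap.
Variables (i j l : D) (A : algebra i) (B : algebra j) (C : algebra l).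
Variables (M M' : bimodule A B) (N N' : bimodule B C).
Variables (u : bimodhom M M') (v : bimodhom N N').

Lemma tens_homE : tens_hom X u v \v tens_pi X M N
  = tens_pi X M' N' \v (bh_val u \h bh_val v).
Proof. exact: descE. Qed.

Lemma tens_hom_r : bm_r (tensor X M' N') \v (tens_hom X u v \h idm C)
  = tens_hom X u v \v bm_r (tensor X M N).
Proof.
apply: (coker_epi (coker_whiskr X C (tens_piP X M N))) => /=.
rewrite -compA whiskr_comp tens_homE -whiskr_comp compA tens_rE.
rewrite -[RHS]compA tens_rE !compA tens_homE -!compA asc_nat; congr (_ \v _).
by rewrite !compA -!interchange comp1m compm1 bh_r.
Qed.

End TensorMap.

Section Projection.
Variables (i j l : D) (A : algebra i) (B : algebra j) (C : algebra l).
Variables (M : bimodule A B) (N : bimodule B C).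

Lemma tens_pi_rlin :
  tens_pi X M N \in rlin (mr_ob M (bm_rmodule N)) (bm_rmodule (tensor X M N)).
Proof. by rewrite inE; apply/eqP; apply: tens_rE'. Qed.

Definition tens_pi_hom :
    rmodhom (mr_ob M (bm_rmodule N)) (bm_rmodule (tensor X M N)) :=
  RModHom tens_pi_rlin.

End Projection.

End TensorFunctoriality.

(** * Tensoring with a bimodule as a morphism of 2-representations *)

Section ScalarExtension.
Variables (K : fieldType) (D : twocat K) (X : right_exact D).

Lemma unit_algA (l : D) : lunit (one l) \v (lunit (one l) \h idm _)
  = lunit (one l) \v (idm _ \h lunit (one l)) \v asc _ _ _.
Proof.
rewrite /lunit /asc whiskl_eqm whiskr_eqm !eqm_trans; exact: eqm_irr.
Qed.

Lemma unit_alg1m (l : D) :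
  lunit (one l) \v (idm (one l) \h idm (one l)) = lunit (one l).
Proof. by rewrite hcomp_id compm1. Qed.

Lemma unit_algm1 (l : D) :
  lunit (one l) \v (idm (one l) \h idm (one l)) = runit (one l).
Proof. by rewrite unit_alg1m /lunit /runit; apply: eqm_irr. Qed.

Definition unit_alg (l : D) : algebra l :=
  Algebra (unit_algA l) (unit_alg1m l) (unit_algm1 l).

Section Triv.
Variables (i l : D) (A : algebra i) (Y : rmodule A l).

Lemma triv_lA : lunit Y \v (alg_mul (unit_alg l) \h idm Y)
  = lunit Y \v (idm (one l) \h lunit Y) \v asc (one l) (one l) Y.
Proof.
rewrite /lunit /asc whiskl_eqm whiskr_eqm !eqm_trans; exact: eqm_irr.
Qed.

Lemma triv_l1 : lunit Y \v (alg_unit (unit_alg l) \h idm Y) = lunit Y.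
Proof. by rewrite hcomp_id compm1. Qed.

Lemma triv_lr : rm_act Y \v (lunit Y \h idm A)
  = lunit Y \v (idm (one l) \h rm_act Y) \v asc (one l) Y A.
Proof. by rewrite lunit_nat -compA asc_lunit. Qed.

(* A right module is a bimodule over the identity algebra, so the tensor
   products of bimodules also cover the action of bimodules on modules.     *)
Definition triv : bimodule (unit_alg l) A :=
  @Bimodule _ _ _ _ (unit_alg l) A Y (lunit Y) (rm_act Y) triv_lA triv_l1
    (rm_actA Y) (rm_act1 Y) triv_lr.

End Triv.

Section TrivHom.
Variables (i l : D) (A : algebra i) (Y Z : rmodule A l) (u : rmodhom Y Z).

Lemma triv_hom_l : bm_l (triv Z) \v (idm (unit_alg l) \h rmodhom_val u)
  = rmodhom_val u \v bm_l (triv Y).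
Proof. exact: lunit_nat. Qed.

Definition triv_hom : bimodhom (triv Y) (triv Z) :=
  @BimodHom _ _ _ _ _ _ (triv Y) (triv Z) (rmodhom_val u) triv_hom_l
    (rmodhomE u).

End TrivHom.

Section Functor.
Variables (i j : D) (A : algebra i) (B : algebra j) (M : bimodule A B).

Definition ext_ob (l : D) (Y : rmodule A l) : rmodule B l :=
  bm_rmodule (tensor X (triv Y) M).

Definition ext_pi (l : D) (Y : rmodule A l) :
  rmodhom (mr_ob Y (bm_rmodule M)) (ext_ob Y) := tens_pi_hom X (triv Y) M.

Lemma ext_piP (l : D) (Y : rmodule A l) :
  is_coker (balance (triv Y) M) (rmodhom_val (ext_pi Y)).
Proof. exact: tens_piP. Qed.

Lemma ext_epi (l : D) (Y : rmodule A l) : epi (rmodhom_val (ext_pi Y)).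
Proof. exact: tens_epi. Qed.

Lemma ext_bal (l : D) (Y : rmodule A l) :
  rmodhom_val (ext_pi Y) \v (rm_act Y \h idm M)
  = rmodhom_val (ext_pi Y) \v (idm Y \h bm_l M) \v asc Y A M.
Proof. exact: (tens_bal X (triv Y) M). Qed.

Lemma ext_map_rlin (l : D) (Y Z : rmodule A l) (u : rmodhom Y Z) :
  tens_hom X (triv_hom u) (bimod_id M) \in rlin (ext_ob Y) (ext_ob Z).
Proof.
rewrite inE; apply/eqP.
exact: (tens_hom_r X (triv_hom u) (bimod_id M)).
Qed.

Definition ext_map (l : D) (Y Z : rmodcat A l) (u : hom Y Z) :
  hom (ext_ob Y : rmodcat B l) (ext_ob Z) := RModHom (ext_map_rlin u).

Lemma ext_mapE (l : D) (Y Z : rmodcat A l) (u : hom Y Z) :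
  rmodhom_val (ext_map u) \v rmodhom_val (ext_pi Y)
  = rmodhom_val (ext_pi Z) \v (rmodhom_val u \h idm M).
Proof. exact: (tens_homE X (triv_hom u) (bimod_id M)). Qed.

Lemma ext_map_lin (l : D) (Y Z : rmodcat A l) :
  linear (fun u : hom Y Z => ext_map u).
Proof.
move=> k u v; apply: rmodhom_ext; apply: (ext_epi (Y := Y)).
rewrite [LHS]ext_mapE /= compDl compZl.
rewrite -/(ext_map u) -/(ext_map v).
rewrite [X in _ = _ *: X + _](ext_mapE u) [X in _ = _ + X](ext_mapE v).
by rewrite hcompDl hcompZl compDr compZr.
Qed.

Lemma ext_map_id (l : D) (Y : rmodcat A l) :
  ext_map (idm Y) = idm (ext_ob Y : rmodcat B l).
Proof.
apply: rmodhom_ext; apply: (ext_epi (Y := Y)).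
by rewrite [LHS]ext_mapE /= hcomp_id compm1 comp1m.
Qed.

Lemma ext_map_comp (l : D) (Y Z W : rmodcat A l) (v : hom Z W) (u : hom Y Z) :
  ext_map (v \v u) = ext_map v \v ext_map u.
Proof.
apply: rmodhom_ext; apply: (ext_epi (Y := Y)).
rewrite [LHS]ext_mapE [in RHS]rmodcat_compE -[RHS]compA ext_mapE compA ext_mapE.
by rewrite -compA whiskr_comp.
Qed.

Definition ext_functor (l : D) : linfunctor (rmodcat A l) (rmodcat B l) :=
  LinFunctor (@ext_map_lin l) (@ext_map_id l) (@ext_map_comp l).

Section Compat.
Variables (l m : D) (F : D l m) (Y : rmodule A l).

Lemma ext_iso_subproof :
  ((idm F \h rmodhom_val (ext_pi Y)) \v asc F Y M)
    \v balance (triv (mr_ob F Y)) M = 0.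
Proof.
rewrite /balance compBr; apply/eqP; rewrite subr_eq0; apply/eqP => /=.
rewrite /mr_act -whiskr_comp -!compA [asc F Y M \v _]compA asc_nat -!compA.
rewrite [(idm F \h _) \v _]compA whiskl_comp ext_bal -!whiskl_comp -!compA.
rewrite [asc F Y M \v _]compA -hcomp_id asc_nat -!compA.
by rewrite [(idm F \h asc _ _ _) \v _]compA pentagon.
Qed.

Definition ext_iso : hom (ext_ob (mr_ob F Y) : D j m) (F \c ext_ob Y) :=
  desc (ext_piP (mr_ob F Y)) ext_iso_subproof.

Lemma ext_isoE : ext_iso \v rmodhom_val (ext_pi (mr_ob F Y))
  = (idm F \h rmodhom_val (ext_pi Y)) \v asc F Y M.
Proof. exact: descE. Qed.

Lemma ext_isoV_subproof :
  (rmodhom_val (ext_pi (mr_ob F Y)) \v ascV F Y M)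
    \v (idm F \h balance (triv Y) M) = 0.
Proof.
rewrite /balance hcompBr compBr; apply/eqP; rewrite subr_eq0; apply/eqP => /=.
(* Precomposing with invertible associators brings the balancing relation of Y, whiskered by F, into
   the form of the balancing relation of F Y. *)
apply: (@iso_epi _ _ _ _ (asc F (Y \c A) M)).
  by exists (ascV F (Y \c A) M); rewrite ascK ascVK.
rewrite -!compA -asc_nat -whiskl_comp -!compA.
apply: (@iso_epi _ _ _ _ (asc F Y A \h idm M)).
  exists (ascV F Y A \h idm M).
  by rewrite !whiskr_comp ascK ascVK !hcomp_id.
rewrite -!compA [(idm F \h asc _ _ _) \v _]compA pentagon.
rewrite ![ascV F Y M \v _]compA ascK comp1m whiskr_comp.
rewrite -[_ \v asc F Y A]/(mr_act F Y) (ext_bal (mr_ob F Y)) -!compA.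
rewrite [ascV F Y M \v _]compA ascV_nat -!compA [ascV F Y _ \v _]compA ascK.
by rewrite comp1m hcomp_id.
Qed.

Definition ext_isoV : hom (F \c ext_ob Y) (ext_ob (mr_ob F Y) : D j m) :=
  desc (coker_whiskl X F (ext_piP Y)) ext_isoV_subproof.

Lemma ext_isoVE : ext_isoV \v (idm F \h rmodhom_val (ext_pi Y))
  = rmodhom_val (ext_pi (mr_ob F Y)) \v ascV F Y M.
Proof. exact: descE. Qed.

(** Composition with [F] preserves the cokernel defining the tensor product of [Y] and [M]. Up to
    associators both objects are therefore cokernels of the same balancing relation. *)
Lemma ext_iso_isoP : is_iso ext_iso.
Proof.
exists ext_isoV; split.
  apply: (ext_epi (Y := mr_ob F Y)).
  by rewrite -compA ext_isoE compA ext_isoVE -compA ascK compm1 comp1m.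
apply: (coker_epi (coker_whiskl X F (ext_piP Y))).
by rewrite -compA ext_isoVE compA ext_isoE -compA ascVK compm1 comp1m.
Qed.

Lemma ext_iso_rlin : ext_iso \in rlin (ext_ob (mr_ob F Y)) (mr_ob F (ext_ob Y)).
Proof.
apply: (rlin_factor (p := ext_pi (mr_ob F Y))).
  exact: coker_epi (coker_whiskr X B (ext_piP (mr_ob F Y))).
rewrite ext_isoE inE; apply/eqP.
rewrite -[rm_act (mr_ob F (ext_ob Y))]
  /((idm F \h rm_act (ext_ob Y)) \v asc F (ext_ob Y) B).
rewrite -whiskr_comp -!compA [asc F _ B \v _]compA asc_nat -!compA.
rewrite [LHS]compA whiskl_comp (rmodhomE (ext_pi Y)).
rewrite /= /mr_act -!whiskl_comp -!compA.
rewrite [asc F Y M \v _]compA -hcomp_id asc_nat -!compA.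
by rewrite [(idm F \h asc _ _ _) \v _]compA pentagon.
Qed.

Definition ext_trm :
    hom (ext_ob (mr_ob F Y) : rmodcat B m) (mr_ob F (ext_ob Y)) :=
  RModHom ext_iso_rlin.

End Compat.

Lemma ext_trm_isoP (l m : D) (F : D l m) (Y : rmodule A l) :
  is_iso (ext_trm F Y).
Proof. by apply: iso_rmodcat; apply: ext_iso_isoP. Qed.

Lemma ext_trm_nat (l m : D) (F G : D l m) (Y Z : rmodcat A l) (a : hom F G)
    (u : hom Y Z) :
  ext_trm G Z \v ext_map (mr_map a u) = mr_map a (ext_map u) \v ext_trm F Y.
Proof.
apply: rmodhom_ext; apply: (ext_epi (Y := mr_ob F Y)).
rewrite !rmodcat_compE -compA (ext_mapE (mr_map a u)) compA ext_isoE.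
rewrite -[RHS]compA ext_isoE -compA asc_nat !compA; congr (_ \v _).
by rewrite /= -!interchange comp1m compm1 (ext_mapE u).
Qed.

(** On the epimorphic projection from ((G F) Y) M the law reduces to the pentagon. *)
Lemma ext_trm_comp (l m n : D) (G : D m n) (F : D l m) (Y : rmodcat A l) :
  eqm (mr_ob_comp G F (ext_ob Y) : _ = _ :> rmodcat B n) \v ext_trm (G \c F) Y
  = mr_map (idm G) (ext_trm F Y) \v ext_trm G (mr_ob F Y)
      \v ext_map (eqm (mr_ob_comp G F Y : _ = _ :> rmodcat A n)).
Proof.
apply: rmodhom_ext; apply: (ext_epi (Y := mr_ob (G \c F) Y)).
rewrite !rmodcat_compE rmodcat_eqm_comp -compA ext_isoE.
rewrite -[RHS]compA ext_mapE rmodcat_eqm_comp -[RHS]compA.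
rewrite [_ \v (_ \v (asc _ _ _ \h _))]compA.
rewrite (ext_isoE G (mr_ob F Y)) -[RHS]/((idm G \h ext_iso F Y) \v _).
rewrite -compA [RHS]compA whiskl_comp.
rewrite ext_isoE -whiskl_comp -[RHS]compA -hcomp_id !compA asc_nat -!compA.
by rewrite [(idm G \h asc _ _ _) \v _]compA pentagon.
Qed.

Lemma ext_trm_one (l : D) (Y : rmodcat A l) :
  eqm (mr_ob_one (ext_ob Y) : _ = _ :> rmodcat B l) \v ext_trm (one l) Y
  = ext_map (eqm (mr_ob_one Y : _ = _ :> rmodcat A l)).
Proof.
apply: rmodhom_ext; apply: (ext_epi (Y := mr_ob (one l) Y)).
rewrite !rmodcat_compE rmodcat_eqm_one -compA ext_isoE ext_mapE rmodcat_eqm_one.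
by rewrite compA lunit_nat -compA asc_lunit.
Qed.

Definition ext_rep : tworep_mor (mod_rep A) (mod_rep B) :=
  @TwoRepMor K D (mod_rep A) (mod_rep B) ext_functor ext_trm ext_trm_isoP
    ext_trm_nat ext_trm_comp ext_trm_one.

End Functor.
End ScalarExtension.

(** * The counit from tensoring with M and then N back to the identity *)

Section Counit.
Variables (K : fieldType) (D : twocat K) (X : right_exact D).
Variables (i j : D) (A : algebra i) (B : algebra j).
Variables (M : bimodule A B) (N : bimodule B A).
Variable f : bimodhom (tensor X M N) (regular A).

Definition pairing : hom (M \c N) A := bh_val f \v tens_pi X M N.

Lemma pairing_bal : pairing \v (bm_r M \h idm N)
  = pairing \v (idm M \h bm_l N) \v asc M B N.
Proof. by rewrite /pairing -[LHS]compA (tens_bal X M N) !compA. Qed.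

Lemma pairing_l : pairing \v (bm_l M \h idm N)
  = alg_mul A \v (idm A \h pairing) \v asc A M N.
Proof.
rewrite /pairing -whiskl_comp [alg_mul A \v _]compA (bh_l f) /=.
rewrite -[_ \v _ \v (idm A \h _)]compA tens_lE -!compA ascK compm1 //.
Qed.

Lemma pairing_rlin :
  pairing \in rlin (mr_ob M (bm_rmodule N)) (reg A).
Proof.
rewrite inE; apply/eqP; rewrite /pairing -whiskr_comp compA.
by rewrite [alg_mul A \v _](bh_r f) -compA tens_rE' compA.
Qed.

Definition pairing_hom : hom (mr_ob M (bm_rmodule N) : rmodcat A i) (reg A) :=
  RModHom pairing_rlin.

Section Module.
Variables (l : D) (Y : rmodule A l).

Let Y2 : rmodcat A l := ext_ob X N (ext_ob X M Y).

Definition ext2_pi : hom (mr_ob (Y \c M) (bm_rmodule N) : rmodcat A l) Y2 :=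
  (ext_pi X N (ext_ob X M Y) : hom (_ : rmodcat A l) _)
    \v mr_map (rmodhom_val (ext_pi X M Y)) (idm (bm_rmodule N : rmodcat A j)).

Lemma ext2_piE : rmodhom_val ext2_pi
  = rmodhom_val (ext_pi X N (ext_ob X M Y))
      \v (rmodhom_val (ext_pi X M Y) \h idm N).
Proof. by []. Qed.

Lemma ext2_epi : epi (rmodhom_val ext2_pi).
Proof.
rewrite ext2_piE; apply: epi_comp; first exact: ext_epi.
by apply: (epi_whiskr X); apply: ext_epi.
Qed.

Lemma ext2_pi_bal1 : rmodhom_val ext2_pi \v ((rm_act Y \h idm M) \h idm N)
  = rmodhom_val ext2_pi \v ((idm Y \h bm_l M) \h idm N) \v (asc Y A M \h idm N).
Proof.
rewrite ext2_piE -!compA !whiskr_comp ext_bal; congr (_ \v (_ \h _)).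
by rewrite compA.
Qed.

(** The first projection is linear over [B], so an element of [B] acting on [M] acts on the first
    tensor product, where the second projection is balanced. *)
Lemma ext2_pi_bal2 : rmodhom_val ext2_pi \v ((idm Y \h bm_r M) \h idm N)
      \v (asc Y M B \h idm N)
  = rmodhom_val ext2_pi \v (idm (Y \c M) \h bm_l N) \v asc (Y \c M) B N.
Proof.
have lin := rmodhomE (ext_pi X M Y).
rewrite [rm_act (mr_ob _ _)]/((idm Y \h bm_r M) \v asc Y M B) in lin.
rewrite ext2_piE -!compA !whiskr_comp -lin -whiskr_comp [LHS]compA.
rewrite (ext_bal X N (ext_ob X M Y)) -!compA asc_nat.
rewrite hcomp_id; congr (_ \v _).
by rewrite !compA whisk_lr whisk_rl.
Qed.

(** In elements, y m n |-> y <m, n>. *)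
Definition ext2_map0 : hom (mr_ob (Y \c M) (bm_rmodule N) : rmodcat A l) Y :=
  act_hom Y \v mr_map (idm (Y : D i l)) pairing_hom
    \v eqm (mr_ob_comp Y M (bm_rmodule N) : _ = _ :> rmodcat A l).

Lemma ext2_map0E : rmodhom_val ext2_map0
  = rm_act Y \v (idm Y \h pairing) \v asc Y M N.
Proof. by rewrite /ext2_map0 rmodcat_compE rmodcat_eqm_comp. Qed.

(** Balancing over [A] is (y a) <m, n> = y (a <m, n>) = y <a m, n>, by associativity of the action
    and left linearity of the pairing. *)
Lemma counit_subproof1 :
  rmodhom_val ext2_map0 \v (balance (triv Y) M \h idm N) = 0.
Proof.
rewrite ext2_map0E /balance hcompBl compBr.
apply/eqP; rewrite subr_eq0; apply/eqP => /=.
rewrite -whiskr_comp -!compA asc_nat hcomp_id.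
rewrite [(idm Y \h _) \v (rm_act Y \h _ \v _)]compA whisk_lr -whisk_rl.
rewrite [rm_act Y \v _]compA [rm_act Y \v _]compA rm_actA -!compA.
rewrite [asc Y A A \v _]compA -hcomp_id asc_nat -!compA.
rewrite [(idm Y \h alg_mul A) \v _]compA whiskl_comp.
rewrite [asc Y M N \v _]compA asc_nat -!compA.
rewrite [(idm Y \h pairing) \v _]compA whiskl_comp pairing_l -!whiskl_comp.
by rewrite -!compA [(idm Y \h asc _ _ _) \v _]compA pentagon.
Qed.

Definition counit1 : hom (ext_ob X M Y \c N) Y :=
  desc (coker_whiskr X N (ext_piP X M Y)) counit_subproof1.

Lemma counit1E : counit1 \v (rmodhom_val (ext_pi X M Y) \h idm N)
  = rmodhom_val ext2_map0.
Proof. exact: descE. Qed.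

(** Balancing over [B] comes from <m b, n> = <m, b n>, tested on the source of the first
    projection. *)
Lemma counit_subproof : counit1 \v balance (triv (ext_ob X M Y)) N = 0.
Proof.
rewrite /balance compBr; apply/eqP; rewrite subr_eq0; apply/eqP.
apply: (coker_epi (coker_whiskr X N (coker_whiskr X B (ext_piP X M Y)))).
rewrite -!compA asc_nat hcomp_id whiskr_comp.
rewrite [bm_r _ \v _](rmodhomE (ext_pi X M Y)).
rewrite -whiskr_comp [LHS]compA counit1E [X in _ = counit1 \v X]compA.
rewrite (whisk_lr (rmodhom_val (ext_pi X M Y)) (bm_l N)).
rewrite -(whisk_rl (rmodhom_val (ext_pi X M Y)) (bm_l N)) !compA counit1E.
rewrite ext2_map0E /= /mr_act -whiskr_comp.
rewrite -!compA [asc Y M N \v _]compA asc_nat -!compA.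
rewrite [(idm Y \h _) \v _]compA whiskl_comp pairing_bal -!whiskl_comp.
rewrite [asc Y M N \v (idm _ \h _ \v _)]compA -hcomp_id asc_nat -!compA.
by rewrite [(idm Y \h asc _ _ _) \v _]compA pentagon.
Qed.

Definition counit0 : hom (Y2 : rmodule A l) (Y : D i l) :=
  desc (ext_piP X N (ext_ob X M Y)) counit_subproof.

Lemma counit0E : counit0 \v rmodhom_val ext2_pi = rmodhom_val ext2_map0.
Proof. by rewrite ext2_piE compA /counit0 descE counit1E. Qed.

Lemma counit_rlin : counit0 \in rlin Y2 Y.
Proof.
apply: (rlin_factor (p := ext2_pi)); last by rewrite counit0E; apply: rmodhomP.
by apply: (epi_whiskr X); apply: ext2_epi.
Qed.

Definition counit : hom Y2 Y := RModHom counit_rlin.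

Hypothesis iso_f : is_iso (bh_val f).

Lemma pairing_coker : is_coker (balance M N) pairing.
Proof. exact: coker_iso_comp (tens_piP X M N) iso_f. Qed.

Let ext2_piV : hom (mr_ob Y (mr_ob M (bm_rmodule N)) : rmodcat A l) Y2 :=
  ext2_pi \v eqm (esym (mr_ob_comp Y M (bm_rmodule N) : _ = _ :> rmodcat A l)).

Let ext2_piVE : rmodhom_val ext2_piV = rmodhom_val ext2_pi \v ascV Y M N.
Proof.
rewrite rmodcat_compE; congr (_ \v _).
by rewrite rmodcat_eqm /ascV; apply: eqm_irr.
Qed.

Let unit_subproof :
  rmodhom_val ext2_piV \v (idm Y \h balance M N) = 0.
Proof.
rewrite /balance hcompBr compBr; apply/eqP; rewrite subr_eq0; apply/eqP.
rewrite ext2_piVE; have := ext2_pi_bal2; move: (rmodhom_val ext2_pi) => p bal2.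
rewrite -!compA ascV_nat -!whiskl_comp.
apply: (@iso_epi _ _ _ _ (asc Y (M \c B) N)).
  by exists (ascV Y (M \c B) N); rewrite ascK ascVK.
apply: (@iso_epi _ _ _ _ (asc Y M B \h idm N)).
  exists (ascV Y M B \h idm N).
  by rewrite !whiskr_comp ascK ascVK !hcomp_id.
rewrite -!compA [ascV Y _ N \v _]compA ascK comp1m [LHS]compA bal2 -!compA.
rewrite [(idm Y \h asc _ _ _) \v _]compA pentagon.
rewrite [ascV Y M N \v _]compA ascV_nat -!compA [ascV Y M _ \v _]compA ascK.
by rewrite comp1m hcomp_id.
Qed.

(** In elements, y <m, n> |-> y m n as a map out of Y A. It is defined because the invertibility of
    [f] makes the pairing a cokernel, which composition with [Y] preserves. *)
Let w0 := desc (coker_whiskl X Y pairing_coker) unit_subproof.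

Let w0E : w0 \v (idm Y \h pairing) = rmodhom_val ext2_piV.
Proof. exact: descE. Qed.

Let w0_rlin : w0 \in rlin (mr_ob Y (reg A)) Y2.
Proof.
apply: (rlin_factor (p := mr_map (idm (Y : D i l)) pairing_hom)).
  apply: (epi_whiskr X).
  exact: coker_epi (coker_whiskl X Y pairing_coker).
by rewrite /= w0E; apply: rmodhomP.
Qed.

(** The map [w0] is balanced over [A], hence factors through the action Y A -> Y by [act_univ]. The
    factor is the inverse of the counit. *)
Lemma counit_iso : is_iso counit.
Proof.
(* Tested on Y A M N: left linearity turns a <m, n> into <a m, n>, and the claim becomes the
   balancing relation [ext2_pi_bal1]. *)
have w_bal : w0 \v (rm_act Y \h idm A)
    = w0 \v (idm Y \h alg_mul A) \v asc Y A A.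
  apply: (coker_epi (coker_whiskl X (Y \c A) pairing_coker)).
  rewrite -!compA whisk_rl -whisk_lr [LHS]compA w0E.
  rewrite -[idm (Y \c A)]hcomp_id asc_nat.
  rewrite [(idm Y \h alg_mul A) \v _]compA whiskl_comp.
  have -> : alg_mul A \v (idm A \h pairing)
      = pairing \v (bm_l M \h idm N) \v ascV A M N.
    by rewrite pairing_l -!compA ascVK compm1.
  rewrite -2!whiskl_comp !compA w0E ext2_piVE.
  have := ext2_pi_bal1; move: (rmodhom_val ext2_pi) => p bal1.
  apply: (@iso_epi _ _ _ _ (asc (Y \c A) M N)).
    by exists (ascV (Y \c A) M N); rewrite ascK ascVK.
  rewrite -!compA -hcomp_id ![ascV Y M N \v (_ \v _)]compA !ascV_nat.
  rewrite -!compA ascK compm1 bal1 -!compA; congr (_ \v (_ \v _)).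
  by rewrite /asc /ascV whiskl_eqm whiskr_eqm !eqm_trans; apply: eqm_irr.
have [v vE] := act_univ (w := RModHom w0_rlin) w_bal.
have {}vE : rmodhom_val v \v rm_act Y = w0.
  exact: (congr1 (fun u : rmodhom _ _ => rmodhom_val u) vE).
have counit0E' :
    counit0 \v rmodhom_val ext2_piV = rm_act Y \v (idm Y \h pairing).
  by rewrite ext2_piVE compA counit0E ext2_map0E -[LHS]compA ascVK compm1.
exists v; split; apply: rmodhom_ext; rewrite rmodcat_compE.
  apply: ext2_epi; rewrite -[LHS]compA counit0E ext2_map0E !compA vE w0E.
  by rewrite ext2_piVE -compA ascK compm1 comp1m.
apply: (act_epi (X := Y)); rewrite -[LHS]compA vE comp1m.
apply: (coker_epi (coker_whiskl X Y pairing_coker)).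
by rewrite -compA w0E.
Qed.

End Module.

Lemma counit_nat (l : D) (Y Z : rmodcat A l) (u : hom Y Z) :
  counit Z \v ext_map X N (ext_map X M u) = u \v counit Y.
Proof.
apply: rmodhom_ext; apply: (ext2_epi (Y := Y)).
rewrite [rmodhom_val (counit Z \v _)]rmodcat_compE.
rewrite [rmodhom_val (u \v _)]rmodcat_compE -[RHS]compA counit0E ext2_piE.
rewrite -[LHS]compA [_ \v (rmodhom_val (ext_pi X N _) \v _)]compA ext_mapE.
rewrite -!compA whiskr_comp.
rewrite ext_mapE -whiskr_comp [rmodhom_val (ext_pi X N _) \v _]compA.
rewrite -ext2_piE compA counit0E !ext2_map0E -!compA asc_nat hcomp_id.
rewrite [(idm Z \h pairing) \v _]compA whisk_lr -whisk_rl !compA.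
by rewrite (rmodhomE u).
Qed.

End Counit.

(** * From invertible pairings to an equivalence of 2-representations *)

Section Backward.
Variables (K : fieldType) (D : twocat K) (X : right_exact D).
Variables (i j : D) (A : algebra i) (B : algebra j).
Variables (M : bimodule A B) (N : bimodule B A).
Variables (f : bimodhom (tensor X M N) (regular A)).
Variables (g : bimodhom (tensor X N M) (regular B)).

(** The counit of [g] is the counit of the equivalence, and the inverse of the counit of [f] is its
    unit. *)
Lemma ext_equivalence : is_iso (bh_val f) -> is_iso (bh_val g) ->
  tworep_equivalent (mod_rep A) (mod_rep B).
Proof.
move=> iso_f iso_g; exists (ext_rep X M) => l; exists (ext_functor X N l).
split; last first.
  exists (counit g (l := l)); split=> [Y|Y Z u]; first exact: counit_iso.
  exact: counit_nat.
exists (fun Y => inv_iso (counit_iso Y iso_f)); split=> [Y|Y Z u].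
  exact: iso_inv.
apply: (iso_epi (counit_iso Y iso_f)).
rewrite -compA -counit_nat compA inv_isoK comp1m -compA inv_isoK.
by rewrite compm1.
Qed.

End Backward.

(** * Bimodule maps out of a tensor product *)

Section BalancedMaps.
Variables (K : fieldType) (D : twocat K) (X : right_exact D).
Variables (i j l : D) (A : algebra i) (B : algebra j) (C : algebra l).
Variables (M : bimodule A B) (N : bimodule B C) (P : bimodule A C).
Variable p : hom (M \c N) P.
Hypothesis p_bal : p \v (bm_r M \h idm N)
  = p \v (idm M \h bm_l N) \v asc M B N.
Hypothesis p_l : p \v (bm_l M \h idm N)
  = bm_l P \v (idm A \h p) \v asc A M N.
Hypothesis p_r : p \in rlin (mr_ob M (bm_rmodule N)) (bm_rmodule P).

Lemma bimodhom_of_balanced :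
  exists f : bimodhom (tensor X M N) P, bh_val f \v tens_pi X M N = p.
Proof.
have p0 : p \v balance M N = 0.
  by rewrite /balance compBr compA p_bal subrr.
pose f := desc (tens_piP X M N) p0.
have fE : f \v tens_pi X M N = p by exact: descE.
have f_l : bm_l P \v (idm A \h f) = f \v bm_l (tensor X M N).
  apply: (coker_epi (coker_whiskl X A (tens_piP X M N))).
  rewrite -!compA whiskl_comp fE tens_lE !compA fE p_l.
  by rewrite -[RHS]compA ascVK compm1.
have f_r : bm_r P \v (f \h idm C) = f \v bm_r (tensor X M N).
  apply: (coker_epi (coker_whiskr X C (tens_piP X M N))).
  rewrite -compA whiskr_comp fE -[RHS]compA tens_rE' compA fE.
  exact/eqP.
by exists (BimodHom (M := tensor X M N) f_l f_r).
Qed.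

(** A factorization [v] of the projection through [p] inverts [f]. Cancellation of [p] is available
    against right module maps, so f v = id is checked among these. *)
Lemma balanced_iso (f : bimodhom (tensor X M N) P)
    (v : rmodhom (bm_rmodule P) (bm_rmodule (tensor X M N))) :
  (forall (Z : rmodule C i) (x y : rmodhom (bm_rmodule P) Z),
     rmodhom_val x \v p = rmodhom_val y \v p -> x = y) ->
  bh_val f \v tens_pi X M N = p -> rmodhom_val v \v p = tens_pi X M N ->
  is_iso (bh_val f).
Proof.
move=> epi_p fE vE.
have f_r : bh_val f \in rlin (bm_rmodule (tensor X M N)) (bm_rmodule P).
  by rewrite inE; apply/eqP; apply: bh_r.
pose fh : hom (bm_rmodule (tensor X M N) : rmodcat C i) (bm_rmodule P) :=
  RModHom f_r.
exists (rmodhom_val v); split.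
  by apply: (tens_epi (M := M) (N := N)); rewrite -compA fE vE comp1m.
suff /(congr1 (fun u : rmodhom _ _ => rmodhom_val u)) :
  fh \v (v : hom (bm_rmodule P : rmodcat C i) _) = idm _ by [].
by apply: epi_p; rewrite /= -compA vE fE comp1m.
Qed.

End BalancedMaps.

(** * The compatibility squares on unquotiented composites *)

Section MoritaSquare.
Variables (K : fieldType) (D : twocat K) (X : right_exact D).
Variables (i j : D) (A : algebra i) (B : algebra j).
Variables (M : bimodule A B) (N : bimodule B A).
Variables (f : bimodhom (tensor X M N) (regular A)).
Variables (g : bimodhom (tensor X N M) (regular B)).

(** Both projections from (M N) M are epimorphisms, so the square may be checked there; it then
    reads <m, n> m' = m <n, m'>. *)
Lemma morita_square :
  bm_l M \v (pairing f \h idm M)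
    = bm_r M \v (idm M \h pairing g) \v asc M N M ->
  tens_lunit X M \v tens_hom X f (bimod_id M)
  = tens_runit X M \v tens_hom X (bimod_id M) g \v tens_assoc X M N M.
Proof.
move=> fg.
apply: (coker_epi (tens_piP X (tensor X M N) M)).
apply: (coker_epi (coker_whiskr X M (tens_piP X M N))).
have lunitE : tens_lunit X M \v tens_pi X (regular A) M = bm_l M.
  exact: descE.
have runitE : tens_runit X M \v tens_pi X M (regular B) = bm_r M.
  exact: descE.
have assocE : tens_assoc X M N M \v tens_pi X (tensor X M N) M
    = tens_assoc1 X M N M by exact: descE.
rewrite -!compA [X in _ = _ \v (_ \v X)]compA assocE tens_assoc1E.
rewrite [tens_hom X f _ \v _]compA (tens_homE X f (bimod_id M)) -compA.
rewrite [tens_lunit X M \v _]compA.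
rewrite lunitE whiskr_comp fg /tens_assoc0 -!compA.
rewrite [tens_hom X _ g \v _]compA (tens_homE X (bimod_id M) g) -!compA.
rewrite [tens_runit X M \v _]compA runitE.
by rewrite [(_ \h bh_val g) \v _]compA whiskl_comp.
Qed.

End MoritaSquare.

(** * Left projectivity from a Morita context *)

Section LeftProjective.
Variables (K : fieldType) (D : twocat K) (X : right_exact D).
Variables (i j : D) (A : algebra i) (B : algebra j).
Variables (M : bimodule A B) (N : bimodule B A).
Variables (f : bimodhom (tensor X M N) (regular A)).
Variables (g : bimodhom (tensor X N M) (regular B)).
Hypothesis iso_g : is_iso (bh_val g).
Hypothesis fg : bm_l M \v (pairing f \h idm M)
    = bm_r M \v (idm M \h pairing g) \v asc M N M.
Hypothesis proj_one : projective (one j : D j j).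

Section Evaluation.
Variables (l : D) (Y : lmodule A l).

(** In elements, m n y |-> <m, n> y. *)
Definition ev0 : hom (M \c (N \c Y)) Y :=
  lm_act Y \v (pairing f \h idm Y) \v ascV M N Y.

Lemma ev0_l : lm_act Y \v (idm A \h ev0)
  = ev0 \v (bm_l M \h idm (N \c Y)) \v ascV A M (N \c Y).
Proof.
rewrite /ev0; move: (pairing f) (pairing_l f) => p p_l.
have lA : lm_act Y \v (idm A \h lm_act Y)
    = lm_act Y \v (alg_mul A \h idm Y) \v ascV A A Y.
  by rewrite lm_actA -compA ascVK compm1.
have p_l' : alg_mul A \v (idm A \h p) = p \v (bm_l M \h idm N) \v ascV A M N.
  by rewrite p_l -compA ascVK compm1.
rewrite -!whiskl_comp !compA lA -!compA [ascV A A Y \v _]compA ascV_nat -!compA.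
rewrite [(alg_mul A \h _) \v _]compA whiskr_comp p_l' -!whiskr_comp -!compA.
congr (_ \v (_ \v _)).
rewrite -hcomp_id [ascV M N Y \v _]compA ascV_nat -!compA.
congr (_ \v _).
by rewrite /asc /ascV whiskl_eqm whiskr_eqm !eqm_trans; apply: eqm_irr.
Qed.

(** Its cokernel is the tensor product over [A] of [N] with the left module [Y]. *)
Definition lbalance : hom ((N \c A) \c Y) (N \c Y) :=
  (bm_r N \h idm Y) - (idm N \h lm_act Y) \v asc N A Y.

Lemma ev_subproof : ev0 \v (idm M \h lbalance) = 0.
Proof.
rewrite /lbalance hcompBr compBr; apply/eqP; rewrite subr_eq0; apply/eqP.
have /eqP := pairing_rlin f; rewrite /= /mr_act.
rewrite /ev0; move: (pairing f) => p p_r.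
apply: (@iso_epi _ _ _ _ (asc M (N \c A) Y)).
  by exists (ascV M (N \c A) Y); rewrite ascK ascVK.
apply: (@iso_epi _ _ _ _ (asc M N A \h idm Y)).
  exists (ascV M N A \h idm Y).
  by rewrite !whiskr_comp ascK ascVK !hcomp_id.
rewrite -!compA -whiskl_comp [ascV M N Y \v _]compA ascV_nat -!compA.
rewrite [ascV M _ Y \v _]compA ascK comp1m !whiskr_comp -p_r -whiskr_comp.
rewrite compA lm_actA -!compA asc_nat hcomp_id.
rewrite [(idm M \h asc _ _ _) \v _]compA pentagon.
rewrite [ascV M N Y \v _]compA ascV_nat -!compA [ascV M N _ \v _]compA ascK.
rewrite comp1m hcomp_id [(p \h idm Y) \v _]compA whisk_rl.
by rewrite -[in RHS]whisk_lr -!compA.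
Qed.

Definition ev : hom (M \c coker X lbalance) Y :=
  desc (coker_whiskl X M (cokerP X lbalance)) ev_subproof.

Lemma evE : ev \v (idm M \h coker_pi X lbalance) = ev0.
Proof. exact: descE. Qed.

End Evaluation.

(* Under N (x)_A M = B the map N (x)_A phi is an element of N (x)_A Z; it lifts
   along e because 1_j is projective, and M (x)_B - brings the lift back.    *)
Lemma left_projective : projective (bm_lmodule M : lmodcat A j).
Proof.
move=> Y Z e phi epi_e.
have phiE := lmodhomE phi; have eE := lmodhomE e.
pose piZ := coker_pi X (lbalance Z).
have phi0 : (piZ \v (idm N \h lmodhom_val phi)) \v balance N M = 0.
  rewrite /balance compBr; apply/eqP; rewrite subr_eq0; apply/eqP.
  rewrite -!compA whisk_lr -whisk_rl [(idm N \h _) \v _]compA whiskl_comp.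
  rewrite -phiE -whiskl_comp -compA -asc_nat hcomp_id !compA.
  congr (_ \v _); apply/eqP; rewrite -subr_eq0 -!compA -compBr.
  by apply/eqP; case: (cokerP X (lbalance Z)).
pose Tphi := desc (tens_piP X N M) phi0.
have TphiE : Tphi \v tens_pi X N M = piZ \v (idm N \h lmodhom_val phi).
  exact: descE.
have epi_t : epi (piZ \v (idm N \h lmodhom_val e)).
  apply: epi_comp; first exact: coker_epi (cokerP X _).
  by apply: (epi_whiskl X); apply: (@lmodcat_epi _ _ X).
have [s sE] := @proj_one _ _ _ (Tphi \v inv_iso iso_g \v alg_unit B) epi_t.
(* With [s] regarded as an element of N Y, this is m |-> ev0 (m s), which is linear in m because
   [ev0] is. *)
pose psi := ev0 Y \v (idm M \h s) \v runitV M.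
have psi_l : psi \in llin (bm_lmodule M) Y.
  rewrite inE; apply/eqP; rewrite /psi; move: (ev0 Y) (ev0_l Y) => c c_l.
  rewrite -!whiskl_comp !compA c_l -!compA.
  rewrite [ascV A M _ \v _]compA ascV_nat hcomp_id -!compA.
  rewrite [(bm_l M \h _) \v _]compA whisk_rl -whisk_lr -!compA.
  congr (_ \v (_ \v _)); rewrite runitV_nat; congr (_ \v _).
  by rewrite /ascV /runitV whiskl_eqm !eqm_trans; apply: eqm_irr.
have ev0_nat : lmodhom_val e \v ev0 Y
    = ev Z \v (idm M \h (piZ \v (idm N \h lmodhom_val e))).
  rewrite -whiskl_comp [RHS]compA evE /ev0 !compA -eE -!compA ascV_nat hcomp_id.
  by rewrite ![_ \v (_ \v ascV _ _ _)]compA whisk_lr whisk_rl.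
(* In elements, <m, n> phi(m') = phi(<m, n> m') = phi(m <n, m'>), the last equality being [fg]. At
   the preimage under [g] of the unit of [B] this gives phi(m). *)
have evT : ev Z \v (idm M \h Tphi)
    = lmodhom_val phi \v bm_r M \v (idm M \h bh_val g).
  apply: (coker_epi (coker_whiskl X M (tens_piP X N M))).
  rewrite -!compA !whiskl_comp TphiE -[bh_val g \v _]/(pairing g).
  rewrite -whiskl_comp compA evE /ev0 -!compA ascV_nat hcomp_id.
  rewrite [(pairing f \h _) \v _]compA whisk_rl -whisk_lr -!compA.
  rewrite [lm_act Z \v _]compA phiE -!compA; congr (_ \v _).
  by rewrite compA /= fg -!compA ascVK compm1.
exists (LModHom psi_l); apply: val_inj; rewrite /= /psi.
move: (ev0 Y) ev0_nat => c c_nat.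
rewrite !compA c_nat -[ev Z \v _ \v _]compA whiskl_comp sE.
rewrite -!whiskl_comp !compA evT -!compA [(idm M \h bh_val g) \v _]compA.
rewrite whiskl_comp inv_isoVK hcomp_id comp1m.
by rewrite [bm_r M \v _]compA bm_r1 runitVK compm1.
Qed.

End LeftProjective.

Definition morita_equivalent (K : fieldType) (D : twocat K)
    (X : right_exact D) (i j : D) (A : algebra i) (B : algebra j) : Prop :=
  exists (M : bimodule A B) (N : bimodule B A),
    [/\ biprojective M, biprojective N
      & exists (f : bimodhom (tensor X M N) (regular A))
               (g : bimodhom (tensor X N M) (regular B)),
        [/\ is_iso (bh_val f), is_iso (bh_val g),
            tens_lunit X M \v tens_hom X f (bimod_id M)
            = tens_runit X M \v tens_hom X (bimod_id M) g \v tens_assoc X M N M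
          & tens_lunit X N \v tens_hom X g (bimod_id N)
            = tens_runit X N \v tens_hom X (bimod_id N) f
                \v tens_assoc X N M N]].

(** * From an equivalence of 2-representations to a Morita context *)

Section Forward.
Variables (K : fieldType) (D : twocat K) (X : right_exact D).
Variables (i j : D) (A : algebra i) (B : algebra j).
Variable Phi : tworep_mor (mod_rep A) (mod_rep B).
Hypothesis equivPhi : forall l, equivalence (Phi l).

Local Notation P l := (Phi l : linfunctor (rmodcat A l) (rmodcat B l)).

Definition msharp (l m : D) (F : D l m) (Y : rmodcat A l) (Z : rmodcat A m)
    (h : hom (mr_ob F Y : rmodcat A m) Z) :
    hom (mr_ob F (P l Y) : rmodcat B m) (P m Z) :=
  sharp Phi h.

Lemma msharp_inj (l m : D) (F : D l m) (Y : rmodcat A l) (Z : rmodcat A m) :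
  injective (@msharp l m F Y Z).
Proof. exact: (@sharp_inj _ _ _ _ Phi equivPhi _ _ F Y Z). Qed.

Lemma msharp_surj (l m : D) (F : D l m) (Y : rmodcat A l) (Z : rmodcat A m)
    (w : hom (mr_ob F (P l Y) : rmodcat B m) (P m Z)) :
  exists h : hom (mr_ob F Y : rmodcat A m) Z, msharp h = w.
Proof. exact: (@sharp_surj _ _ _ _ Phi equivPhi _ _ F Y Z w). Qed.

Lemma msharp_post (l m : D) (F : D l m) (Y : rmodcat A l) (Z W : rmodcat A m)
    (h : hom (mr_ob F Y : rmodcat A m) Z) (v : hom Z W) :
  fmap (P m) v \v msharp h = msharp (v \v h).
Proof. exact: (sharp_post Phi h v). Qed.

Lemma msharp_pre (l m : D) (F G : D l m) (Y : rmodcat A l) (Z : rmodcat A m)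
    (h : hom (mr_ob F Y : rmodcat A m) Z) (a : hom G F) :
  msharp h \v mr_map a (idm (P l Y)) = msharp (h \v mr_map a (idm Y)).
Proof.
rewrite -(fmap_id (P l)); exact: (sharp_pre Phi h a (idm Y)).
Qed.

Lemma msharp_comp (l m n : D) (G : D m n) (F : D l m) (Y : rmodcat A l)
    (Z : rmodcat A m) (W : rmodcat A n) (h : hom (mr_ob G Z : rmodcat A n) W)
    (k : hom (mr_ob F Y : rmodcat A m) Z) :
  msharp h \v mr_map (idm G) (msharp k)
    \v eqm (mr_ob_comp G F (P l Y) : _ = _ :> rmodcat B n)
  = msharp (h \v mr_map (idm G) k
             \v eqm (mr_ob_comp G F Y : _ = _ :> rmodcat A n)).
Proof. exact: (sharp_comp Phi h k). Qed.

Lemma msharp_one (l : D) (Y : rmodcat A l) :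
  msharp (eqm (mr_ob_one Y : _ = _ :> rmodcat A l))
  = eqm (mr_ob_one (P l Y) : _ = _ :> rmodcat B l).
Proof. exact: (sharp_one Phi Y). Qed.

Lemma msharp_epi (l m : D) (F : D l m) (Y : rmodcat A l) (Z : rmodcat A m)
    (h : hom (mr_ob F Y : rmodcat A m) Z) : epi h -> epi (msharp h).
Proof.
move=> epi_h; apply: epi_comp; first exact: equiv_epi.
exact: iso_epi (iso_inv _).
Qed.

Lemma msharp_preE (l m : D) (F G : D l m) (Y : rmodcat A l) (Z : rmodcat A m)
    (h : hom (mr_ob F Y : rmodcat A m) Z) (a : hom G F) :
  rmodhom_val (msharp h) \v (a \h idm (P l Y : D j l))
  = rmodhom_val (msharp (h \v mr_map a (idm Y))).
Proof. by rewrite -msharp_pre. Qed.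

Lemma msharp_compE (l m n : D) (G : D m n) (F : D l m) (Y : rmodcat A l)
    (Z : rmodcat A m) (W : rmodcat A n) (h : hom (mr_ob G Z : rmodcat A n) W)
    (k : hom (mr_ob F Y : rmodcat A m) Z) :
  rmodhom_val (msharp h) \v (idm G \h rmodhom_val (msharp k))
    \v asc G F (P l Y)
  = rmodhom_val (msharp (h \v mr_map (idm G) k
             \v eqm (mr_ob_comp G F Y : _ = _ :> rmodcat A n))).
Proof.
rewrite -msharp_comp !(rmodcat_compE (_ \v _)) rmodcat_compE.
by rewrite rmodcat_eqm_comp.
Qed.

Lemma msharp_oneE (l : D) (Y : rmodcat A l) :
  rmodhom_val (msharp (eqm (mr_ob_one Y : _ = _ :> rmodcat A l)))
  = lunit (P l Y).
Proof. by rewrite msharp_one rmodcat_eqm_one. Qed.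

Let Mr : rmodcat B i := P i (reg A).
Let actA : hom (mr_ob (A : D i i) (reg A) : rmodcat A i) (reg A) :=
  act_hom (reg A).
Let actB : hom (mr_ob (B : D j j) (reg B) : rmodcat B j) (reg B) :=
  act_hom (reg B).
Let lM : hom (A \c rm_car Mr) (rm_car Mr) := rmodhom_val (msharp actA).

Let lM_A : lM \v (alg_mul A \h idm (rm_car Mr))
  = lM \v (idm A \h lM) \v asc A A (rm_car Mr).
Proof.
(* Both sides are sharps of maps out of A A A, and those agree by associativity of [A]. *)
rewrite msharp_preE msharp_compE; congr (rmodhom_val (msharp _)).
apply: rmodhom_ext; rewrite !rmodcat_compE rmodcat_eqm_comp.
exact: alg_mulA.
Qed.

Let lM_1 : lM \v (alg_unit A \h idm (rm_car Mr)) = lunit (rm_car Mr).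
Proof.
rewrite msharp_preE -msharp_oneE; congr (rmodhom_val (msharp _)).
apply: rmodhom_ext; rewrite !rmodcat_compE rmodcat_eqm_one.
exact: alg_mul1m.
Qed.

Let lM_r : rm_act Mr \v (lM \h idm B)
  = lM \v (idm A \h rm_act Mr) \v asc A (rm_car Mr) B.
Proof. by rewrite (rmodhomE (msharp actA)) /= /mr_act compA. Qed.

Definition morita_bimodule : bimodule A B :=
  @Bimodule _ _ _ _ A B (rm_car Mr) lM (rm_act Mr) lM_A lM_1 (rm_actA Mr)
    (rm_act1 Mr) lM_r.

Section Inverse.
Variables (Nr : rmodcat A j) (e : hom (P j Nr) (reg B)).
Variable e' : hom (reg B : rmodcat B j) (P j Nr).
Hypotheses (e'e : e' \v e = idm _) (ee' : e \v e' = idm _).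
Variable beta : hom (mr_ob (B : D j j) Nr : rmodcat A j) Nr.
Hypothesis betaE :
  msharp beta = e' \v (actB \v mr_map (idm (B : D j j)) e).
Variable ft : hom (mr_ob (rm_car Mr) Nr : rmodcat A i) (reg A).
Hypothesis ftE :
  msharp ft = act_hom Mr \v mr_map (idm (rm_car Mr)) e.

Let eV := rmodhom_val e.
Let eV' := rmodhom_val e'.

Let e'eV : eV' \v eV = idm _.
Proof. by rewrite /eV /eV' -rmodcat_compE e'e. Qed.

Let ee'V : eV \v eV' = idm _.
Proof. by rewrite /eV /eV' -rmodcat_compE ee'. Qed.

Let betaV : rmodhom_val (msharp beta) = eV' \v (alg_mul B \v (idm B \h eV)).
Proof. by rewrite betaE. Qed.

Let ftV : rmodhom_val (msharp ft) = rm_act Mr \v (idm (rm_car Mr) \h eV).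
Proof. by rewrite ftE. Qed.

Let lN := rmodhom_val beta.

Let lN_A : lN \v (alg_mul B \h idm (rm_car Nr))
  = lN \v (idm B \h lN) \v asc B B (rm_car Nr).
Proof.
suff h : beta \v mr_map (alg_mul B) (idm Nr)
    = beta \v mr_map (idm (B : D j j)) beta
      \v eqm (mr_ob_comp B B Nr : _ = _ :> rmodcat A j).
  have := congr1 (fun w : rmodhom _ _ => rmodhom_val w) h.
  by rewrite /= rmodcat_eqm_comp.
(* By injectivity the law is compared after applying sharp, where [beta] becomes the multiplication
   of [B] up to [e] and the law its associativity. *)
apply: msharp_inj; apply: rmodhom_ext; rewrite -msharp_preE -msharp_compE betaV.
rewrite -!compA whisk_lr -whisk_rl [(idm B \h eV) \v (idm B \h _ \v _)]compA.
rewrite whiskl_comp [eV \v _]compA ee'V comp1m -whiskl_comp -!compA -asc_nat.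
by rewrite hcomp_id; congr (_ \v _); rewrite !compA alg_mulA.
Qed.

Let lN_1 : lN \v (alg_unit B \h idm (rm_car Nr)) = lunit (rm_car Nr).
Proof.
suff h : beta \v mr_map (alg_unit B) (idm Nr)
    = eqm (mr_ob_one Nr : _ = _ :> rmodcat A j).
  have := congr1 (fun w : rmodhom _ _ => rmodhom_val w) h.
  by rewrite /= rmodcat_eqm_one.
apply: msharp_inj; apply: rmodhom_ext; rewrite -msharp_preE msharp_oneE betaV.
rewrite -!compA whisk_lr -whisk_rl [alg_mul B \v _]compA alg_mul1m lunit_nat.
by rewrite compA e'eV comp1m.
Qed.

Let lN_r : rm_act Nr \v (lN \h idm A)
  = lN \v (idm B \h rm_act Nr) \v asc B (rm_car Nr) A.
Proof. by rewrite (rmodhomE beta) /= /mr_act compA. Qed.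

Definition morita_inverse : bimodule B A :=
  @Bimodule _ _ _ _ B A (rm_car Nr) lN (rm_act Nr) lN_A lN_1 (rm_actA Nr)
    (rm_act1 Nr) lN_r.

Local Notation M := morita_bimodule.
Local Notation N := morita_inverse.

Let p : hom (M \c N) A := rmodhom_val ft.
Let actN : hom (mr_ob (rm_car Nr) (reg A) : rmodcat A j) Nr := act_hom Nr.
Let gt : hom (mr_ob (rm_car Nr) Mr : rmodcat B j) (reg B) := e \v msharp actN.
Let q : hom (N \c M) B := rmodhom_val gt.

(** Under sharp, [ft] becomes the right action of [B] on [M] up to [e], and balancing becomes the
    associativity of this action. *)
Let p_bal : p \v (bm_r M \h idm N) = p \v (idm M \h bm_l N) \v asc M B N.
Proof.
suff h : ft \v mr_map (rm_act Mr) (idm Nr) = ft \v mr_map (idm (rm_car Mr)) beta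
    \v eqm (mr_ob_comp (rm_car Mr) B Nr : _ = _ :> rmodcat A i).
  have := congr1 (fun w : rmodhom _ _ => rmodhom_val w) h.
  by rewrite /= rmodcat_eqm_comp.
apply: msharp_inj; apply: rmodhom_ext; rewrite -msharp_preE -msharp_compE.
rewrite ftV betaV -!compA whisk_lr -whisk_rl.
rewrite [(idm _ \h eV) \v _]compA whiskl_comp [eV \v _]compA ee'V comp1m.
by rewrite -whiskl_comp -!compA -asc_nat hcomp_id !compA rm_actA.
Qed.

Let p_l : p \v (bm_l M \h idm N)
  = bm_l (regular A) \v (idm A \h p) \v asc A M N.
Proof.
suff h : ft \v mr_map lM (idm Nr) = actA \v mr_map (idm (A : D i i)) ft
    \v eqm (mr_ob_comp A (rm_car Mr) Nr : _ = _ :> rmodcat A i).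
  have := congr1 (fun w : rmodhom _ _ => rmodhom_val w) h.
  by rewrite /= rmodcat_eqm_comp.
apply: msharp_inj; apply: rmodhom_ext; rewrite -msharp_preE -msharp_compE.
rewrite ftV -!compA whisk_lr -whisk_rl compA lM_r -!compA.
by rewrite -whiskl_comp -!compA -asc_nat hcomp_id.
Qed.

Let p_r : p \in rlin (mr_ob M (bm_rmodule N)) (bm_rmodule (regular A)).
Proof. exact: (rmodhomP ft). Qed.

(** Up to [e] this is the sharp of the associativity of the right action of [A] on [N]. *)
Let q_bal : q \v (bm_r N \h idm M) = q \v (idm N \h bm_l M) \v asc N A M.
Proof.
have h : rmodhom_val (msharp actN) \v (rm_act Nr \h idm (rm_car Mr))
    = rmodhom_val (msharp actN) \v (idm (rm_car Nr) \h lM) \v asc _ A _.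
  rewrite [LHS]msharp_preE [RHS](msharp_compE actN actA).
  congr (rmodhom_val (msharp _)).
  apply: rmodhom_ext; rewrite !rmodcat_compE rmodcat_eqm_comp.
  exact: rm_actA.
rewrite /q /gt rmodcat_compE; move: (rmodhom_val (msharp actN)) h => m h.
by rewrite -[LHS]compA [X in _ \v X]h !compA.
Qed.

Let q_l : q \v (bm_l N \h idm M)
  = bm_l (regular B) \v (idm B \h q) \v asc B N M.
Proof.
have h : rmodhom_val (msharp actN) \v (lN \h idm (rm_car Mr))
    = rmodhom_val (msharp beta) \v (idm B \h rmodhom_val (msharp actN))
        \v asc B _ _.
  rewrite [LHS]msharp_preE [RHS](msharp_compE beta actN).
  congr (rmodhom_val (msharp _)).
  apply: rmodhom_ext; rewrite !rmodcat_compE rmodcat_eqm_comp.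
  exact: lN_r.
rewrite /q /gt rmodcat_compE; move: (rmodhom_val (msharp actN)) h => m.
rewrite betaV => h; rewrite -[LHS]compA [X in _ \v X]h -!compA.
rewrite [rmodhom_val e \v (eV' \v _)]compA ee'V comp1m.
by rewrite [(idm B \h eV) \v _]compA whiskl_comp.
Qed.

Let q_r : q \in rlin (mr_ob N (bm_rmodule M)) (bm_rmodule (regular B)).
Proof. exact: (rmodhomP gt). Qed.

(** Both sides are sharps, and the equality below is the right linearity of [ft] over [A]. *)
Let pq : bm_l M \v (p \h idm M) = bm_r M \v (idm M \h q) \v asc M N M.
Proof.
rewrite /q /gt rmodcat_compE -whiskl_comp [bm_r M \v _]compA -[bm_r M \v _]ftV.
rewrite [LHS]msharp_preE [RHS](msharp_compE ft actN).
congr (rmodhom_val (msharp _)).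
apply: rmodhom_ext; rewrite !rmodcat_compE rmodcat_eqm_comp.
by rewrite [LHS](rmodhomE ft) /= /mr_act compA.
Qed.

(** After sharp and removal of [e] and [e'], this becomes the right linearity of [q] over [B]. *)
Let qp : bm_l N \v (q \h idm N) = bm_r N \v (idm N \h p) \v asc N M N.
Proof.
suff h : beta \v mr_map q (idm Nr) = actN \v mr_map (idm (rm_car Nr)) ft
    \v eqm (mr_ob_comp (rm_car Nr) (rm_car Mr) Nr : _ = _ :> rmodcat A j).
  have := congr1 (fun w : rmodhom _ _ => rmodhom_val w) h.
  by rewrite /= rmodcat_eqm_comp.
apply: msharp_inj; apply: rmodhom_ext; rewrite -msharp_preE -msharp_compE.
have gtE : rmodhom_val (msharp actN) = eV' \v q.
  by rewrite /q /gt rmodcat_compE compA e'eV comp1m.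
rewrite ftV betaV gtE.
have /eqP := q_r; rewrite -[rm_act (bm_rmodule (regular B))]/(alg_mul B).
rewrite -[rm_act (mr_ob N (bm_rmodule M))]/(mr_act _ _) /mr_act.
move: (q) => m h; rewrite -!compA whisk_lr -whisk_rl; congr (_ \v _).
rewrite [LHS]compA [X in X \v _]h -whiskl_comp -!compA -asc_nat.
by rewrite hcomp_id.
Qed.

Let mr_map_e'e :
  mr_map (idm (rm_car Mr)) e' \v mr_map (idm (rm_car Mr)) e = idm _.
Proof. by rewrite -mr_map_comp comp1m e'e mr_map_id. Qed.

(** The sharp of [ft] is an isomorphism followed by the action of [B] on [M], which is epi;
    faithfulness of [Phi] reflects this. *)
Let epi_p : epi ft.
Proof.
move=> Z u v uv; apply: (equiv_faithful (equivPhi i)).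
suff epi_ft : epi (msharp ft) by apply: epi_ft; rewrite !msharp_post uv.
rewrite ftE; apply: epi_comp; first by apply: epi_rmodcat; apply: act_epi.
apply: (section_epi (s := mr_map (idm (rm_car Mr)) e')).
by rewrite -mr_map_comp comp1m ee' mr_map_id.
Qed.

(** The sharp of the projection M N -> T, composed with [e'], is a balanced map M B -> Phi(T). It
    factors through the action onto M = Phi(A), and fullness returns the factor to a map A -> T. *)
Let p_factor : exists v : rmodhom (reg A) (bm_rmodule (tensor X M N)),
  rmodhom_val v \v p = tens_pi X M N.
Proof.
pose T : rmodcat A i := bm_rmodule (tensor X M N).
pose w : hom (mr_ob (rm_car Mr) Nr : rmodcat A i) T :=
  @RModHom _ _ _ _ _ (mr_ob (rm_car Mr) Nr) T _ (tens_pi_rlin X M N).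
have h : rmodhom_val (msharp w) \v (rm_act Mr \h idm (rm_car (P j Nr)))
    = rmodhom_val (msharp w) \v (idm (rm_car Mr) \h rmodhom_val (msharp beta))
        \v asc _ B _.
  rewrite [LHS]msharp_preE [RHS](msharp_compE w beta).
  congr (rmodhom_val (msharp _)).
  apply: rmodhom_ext; rewrite !rmodcat_compE rmodcat_eqm_comp.
  exact: (tens_bal X M N).
pose w1 := msharp w \v mr_map (idm (rm_car Mr)) e'.
have w1_bal : rmodhom_val w1 \v (rm_act Mr \h idm B)
    = rmodhom_val w1 \v (idm (rm_car Mr) \h alg_mul B) \v asc _ B B.
  rewrite rmodcat_compE -[rmodhom_val (mr_map _ e')]/(idm (rm_car Mr) \h eV').
  move: (rmodhom_val (msharp w)) h => m; rewrite betaV => h.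
  rewrite -[LHS]compA whisk_lr -whisk_rl [LHS]compA h -!compA -hcomp_id asc_nat.
  rewrite [(idm _ \h _) \v (idm _ \h _ \v _)]compA whiskl_comp -!compA.
  rewrite whiskl_comp ee'V hcomp_id compm1.
  by rewrite [(idm _ \h eV') \v _]compA whiskl_comp.
have [v1 v1E] := act_univ w1_bal.
have [v vE] := equiv_full (equivPhi i) (v1 : hom (P i (reg A)) (P i T)).
suff : v \v ft = w.
  by move/(congr1 (fun u : rmodhom _ _ => rmodhom_val u)); exists v.
apply: msharp_inj; rewrite -msharp_post [fmap _ v]vE ftE compA.
by rewrite v1E /w1 -compA mr_map_e'e compm1.
Qed.

Let epi_q : epi gt.
Proof.
apply: epi_comp; first by apply: iso_epi; exists e'.
by apply: msharp_epi; apply: epi_rmodcat; apply: act_epi.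
Qed.

(** Here T is a [B]-module and is first replaced by an isomorphic Phi(R). The projection becomes the
    sharp of a balanced map N A -> R, which factors through the action as N -> R; its image under
    [Phi], between [e'] and [r], is the required map B -> T. *)
Let q_factor : exists v : rmodhom (reg B) (bm_rmodule (tensor X N M)),
  rmodhom_val v \v q = tens_pi X N M.
Proof.
pose T : rmodcat B j := bm_rmodule (tensor X N M).
pose w : hom (mr_ob (rm_car Nr) Mr : rmodcat B j) T :=
  @RModHom _ _ _ _ _ (mr_ob (rm_car Nr) Mr) T _ (tens_pi_rlin X N M).
have [R [r [r' [r'r rr']]]] := equiv_esurj (equivPhi j) T.
have [w' w'E] := msharp_surj (r' \v w).
have w'_bal : rmodhom_val w' \v (rm_act Nr \h idm A)
    = rmodhom_val w' \v (idm (rm_car Nr) \h alg_mul A) \v asc _ A A.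
  suff h : w' \v mr_map (rm_act Nr) (idm _)
      = w' \v mr_map (idm (rm_car Nr)) actA
        \v eqm (mr_ob_comp (rm_car Nr) A (reg A) : _ = _ :> rmodcat A j).
    have := congr1 (fun u : rmodhom _ _ => rmodhom_val u) h.
    by rewrite !rmodcat_compE rmodcat_eqm_comp.
  apply: msharp_inj; apply: rmodhom_ext; rewrite -msharp_preE -msharp_compE.
  rewrite w'E rmodcat_compE -!compA; congr (_ \v _); rewrite compA.
  exact: (tens_bal X N M).
have [v' v'E] := act_univ w'_bal.
suff : r \v fmap (P j) v' \v e' \v gt = w.
  move/(congr1 (fun u : rmodhom _ _ => rmodhom_val u)).
  by exists (r \v fmap (P j) v' \v e').
rewrite -!compA [e' \v _]compA e'e comp1m msharp_post [v' \v actN]v'E w'E.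
by rewrite compA rr' comp1m.
Qed.

Hypothesis proj_i : projective (one i : D i i).
Hypothesis proj_j : projective (one j : D j j).

Let reg_proj (l : D) (E : algebra l) :
  projective (one l : D l l) -> projective (reg E : rmodcat E l).
Proof.
move=> proj_l; apply: reg_projective => // Y Z u.
exact: (@rmodcat_epi _ _ X).
Qed.

(** Its image under [Phi] is isomorphic to the projective regular module of [B], and equivalences
    reflect projectives. *)
Let projN : projective (Nr : rmodcat A j).
Proof.
apply: (equiv_projective_reflect (equivPhi j)).
by apply: (iso_projective (f := e)); [exists e'|apply: reg_proj].
Qed.

Lemma morita_context_of_inverse : morita_equivalent X A B.
Proof.
have [f fE] := bimodhom_of_balanced X (P := regular A) p_bal p_l p_r.
have [g gE] := bimodhom_of_balanced X (P := regular B) q_bal q_l q_r.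
have iso_f : is_iso (bh_val f).
  have [v vE] := p_factor; apply: balanced_iso fE vE => Z x y xy.
  by apply: epi_p; apply: rmodhom_ext.
have iso_g : is_iso (bh_val g).
  have [v vE] := q_factor; apply: balanced_iso gE vE => Z x y xy.
  by apply: epi_q; apply: rmodhom_ext.
have pq' := pq; have qp' := qp.
rewrite -fE -gE in pq' qp'.
exists M, N; split.
(* Left projectivity comes from the context itself, right projectivity from M = Phi(A) with A
   projective over itself. *)
- split; first exact: (left_projective iso_g pq' proj_j).
  have -> : bm_rmodule M = Mr := rmodule_eta Mr.
  apply: (@equiv_projective _ _ _ (P i) (equivPhi i)).
  by apply: reg_proj.
- split; first exact: (left_projective iso_f qp' proj_i).
  have -> : bm_rmodule N = Nr := rmodule_eta Nr.
  exact: projN.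
by exists f, g; split => //; apply: morita_square.
Qed.

End Inverse.

Lemma morita_context : projective (one i : D i i) ->
  projective (one j : D j j) ->
  morita_equivalent X A B.
Proof.
have [Nr [e [e' [e'e ee']]]] := equiv_esurj (equivPhi j) (reg B).
have [beta betaE] := msharp_surj (e' \v (actB \v mr_map (idm (B : D j j)) e)).
have [ft ftE] := msharp_surj (act_hom Mr \v mr_map (idm (rm_car Mr)) e).
exact: (morita_context_of_inverse e'e ee' betaE ftE).
Qed.
End Forward.

Theorem theorem5p3 (K : closedFieldType) (C : twocat K) (fiatC : fiat C)
    (i j : abel C) (A : algebra i) (B : algebra j) :
  tworep_equivalent (mod_rep A) (mod_rep B) <->
  exists (M : bimodule A B) (N : bimodule B A),
    [/\ biprojective M, biprojective N
      & exists (f : bimodhom (tensor (abel_rex C) M N) (regular A))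
               (g : bimodhom (tensor (abel_rex C) N M) (regular B)),
        [/\ is_iso (bh_val f), is_iso (bh_val g),
            tens_lunit (abel_rex C) M \v tens_hom (abel_rex C) f (bimod_id M)
            = tens_runit (abel_rex C) M
                \v tens_hom (abel_rex C) (bimod_id M) g
                \v tens_assoc (abel_rex C) M N M
          & tens_lunit (abel_rex C) N \v tens_hom (abel_rex C) g (bimod_id N)
            = tens_runit (abel_rex C) N
                \v tens_hom (abel_rex C) (bimod_id N) f
                \v tens_assoc (abel_rex C) N M N]].
Proof.
(* The identity 1-morphism of the abelianization has an empty list of relations. *)
have proj_one k : projective (one k : abel C k k) by exact: abel_projective.
split=> [[Phi equivPhi]|[M [N [_ _ [f [g [iso_f iso_g _ _]]]]]]].
  exact: (morita_context (abel_rex C) equivPhi).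
exact: (ext_equivalence iso_f iso_g).
Qed.
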